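(* Let $X$ be a real Banach space with $\dim X\ge 3$ such that every element of $X$ is a Flinn element, i.e. $\mathcal{F}(X)=X$. Then $X$ is isometric to a Hilbert space.
   Context: A bounded linear operator $T:X\to X$ on a real Banach space is numerically positive if for every $x\in X$ and every $x^*\in X^*$ with $\|x^*\|^2=\|x\|^2=x^*(x)$ one has $x^*(Tx)\ge 0$. An element $u\in X$ is a Flinn element if there is a numerically positive linear projection of $X$ onto $\operatorname{span}\{u\}$; for $u\neq 0$ this means there exists $f\in X^*$ with $f(u)=1$ such that the map $f\otimes u: x\mapsto f(x)u$ is numerically positive (then $(u,f)$ is called a Flinn pair). The element $0$ is a Flinn element (the zero projection). $\mathcal{F}(X)$ denotes the set of all Flinn elements of $X$. *)

(* Defs.v *)
From HB Require Import structures.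
From mathcomp Require Import all_boot all_order all_algebra.
From mathcomp Require Import all_classical all_reals all_analysis.
Set Implicit Arguments. Unset Strict Implicit. Unset Printing Implicit Defensive.
Import Order.TTheory GRing.Theory Num.Theory.
Import numFieldNormedType.Exports.
Local Open Scope classical_set_scope.
Local Open Scope ring_scope.

Definition lin_fun {R : realType} {V : normedModType R} (f : V -> R) : Prop :=
  forall (a : R) (x y : V), f (a *: x + y) = a * f x + f y.

Definition lin_op {R : realType} {V : normedModType R} (T : V -> V) : Prop :=
  forall (a : R) (x y : V), T (a *: x + y) = a *: T x + T y.

Definition dual_elt {R : realType} {V : normedModType R} (f : V -> R) : Prop :=
  lin_fun f /\ continuous f.

Definition dual_norm {R : realType} {V : normedModType R} (f : V -> R) : R :=
  sup [set `|f y| | y in [set y : V | `|y| <= 1]].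

Definition num_positive {R : realType} {V : normedModType R} (T : V -> V) : Prop :=
  lin_op T /\ continuous T /\
  forall (x : V) (f : V -> R), dual_elt f ->
    dual_norm f ^+ 2 = `|x| ^+ 2 -> `|x| ^+ 2 = f x -> 0 <= f (T x).

Definition flinn {R : realType} {V : normedModType R} (u : V) : Prop :=
  exists P : V -> V, num_positive P /\ (forall x, P (P x) = P x) /\
    range P = [set r *: u | r in [set: R]].

Definition dim_ge3 {R : realType} (V : normedModType R) : Prop :=
  exists x1 x2 x3 : V, forall a b c : R,
    a *: x1 + b *: x2 + c *: x3 = 0 -> [/\ a = 0, b = 0 & c = 0].

(* V is isometric to a Hilbert space: its norm is induced by an inner product
   (V being complete, (V, B) is then a Hilbert space and id an isometry) *)
Definition hilbertian {R : realType} (V : normedModType R) : Prop :=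
  exists B : V -> V -> R,
    (forall x y, B x y = B y x) /\
    (forall (a : R) (x y z : V), B (a *: x + y) z = a * B x z + B y z) /\
    (forall x, B x x = `|x| ^+ 2).

(* Main.v *)
Require Import Defs.
From HB Require Import structures.
From mathcomp Require Import all_boot all_order all_algebra.
From mathcomp Require Import all_classical all_reals all_analysis.
From mathcomp Require Import ring lra.
Set Implicit Arguments. Unset Strict Implicit. Unset Printing Implicit Defensive.
Import Order.TTheory GRing.Theory Num.Theory.
Import numFieldNormedType.Exports.
Local Open Scope classical_set_scope.
Local Open Scope ring_scope.

(** Norming functionals turn a Flinn pair (u, f) into the statement that the
    projection x |-> x - f(x) u is a contraction, i.e. that every x in ker f is
    Birkhoff orthogonal to u.  In dimension at least 3 the functional f = F u is
    unique, and F u x = 0 exactly when x is Birkhoff orthogonal to u.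
    Composing the projections of u and of v in ker F u shows that F w lies in
    the span of F u and F v whenever w lies in the span of u and v; moreover
    F u and F v are parallel only if u and v are.  As in the fundamental theorem
    of projective geometry, positive rescalings of the F u therefore depend
    linearly on u in any given plane, and yield a bilinear form B there such
    that z is Birkhoff orthogonal to w iff B(z, w) = 0.  Along an affine line
    of the plane the ratio |z|^2 / B(z, z) has a derivative of constant sign
    and the same limit at both ends, so it is constant: the norm is quadratic
    on every plane, and the Jordan-von Neumann argument concludes. *)

(** * Deciding vector identities *)

Inductive vexp (K : Type) :=
  | VZero
  | VVar of nat
  | VAdd of vexp K & vexp K
  | VOpp of vexp K
  | VScale of K & vexp K.

Arguments VZero {K}.
Arguments VVar {K}.

Section VectorExpressions.
Context {K : comPzRingType} {W : lmodType K}.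

Fixpoint veval (env : seq W) (e : vexp K) : W :=
  match e with
  | VZero => 0
  | VVar n => env`_n
  | VAdd a b => veval env a + veval env b
  | VOpp a => - veval env a
  | VScale r a => r *: veval env a
  end.

(** Indices are compared by [Nat.eqb], which [cbn] evaluates on numerals, so that [vect] leaves
    plain equations between scalars. *)
Fixpoint vcoef (e : vexp K) (n : nat) : K :=
  match e with
  | VZero => 0
  | VVar m => if Nat.eqb m n then 1 else 0
  | VAdd a b => vcoef a n + vcoef b n
  | VOpp a => - vcoef a n
  | VScale r a => r * vcoef a n
  end.

Fixpoint vcoefs_eq (a b : vexp K) (n : nat) : Prop :=
  if n is m.+1 then vcoefs_eq a b m /\ vcoef a m = vcoef b m else True.

Lemma veval_coef env e :
  veval env e = \sum_(i < size env) vcoef e i *: env`_i.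
Proof.
elim: e => [|n|a IHa b IHb|a IHa|r a IHa] /=.
- by rewrite big1 // => i _; rewrite scale0r.
- have [ltn|gen] := ltnP n (size env); last first.
    rewrite nth_default // big1 // => i _.
    case: (PeanoNat.Nat.eqb_spec n i) => [nE|_]; last by rewrite scale0r.
    by move: (ltn_ord i); rewrite -nE ltnNge gen.
  rewrite (bigD1 (Ordinal ltn)) //= PeanoNat.Nat.eqb_refl scale1r big1 ?addr0 //.
  move=> i /eqP ni; case: (PeanoNat.Nat.eqb_spec n i) => [nE|_].
    by case: ni; apply: val_inj.
  by rewrite scale0r.
- by rewrite IHa IHb -big_split; apply: eq_bigr => i _; rewrite scalerDl.
- by rewrite IHa -sumrN; apply: eq_bigr => i _; rewrite scaleNr.
- by rewrite IHa scaler_sumr; apply: eq_bigr => i _; rewrite scalerA.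
Qed.

Lemma veval_eq env a b : vcoefs_eq a b (size env) -> veval env a = veval env b.
Proof.
move=> ab; rewrite !veval_coef; apply: eq_bigr => -[i /= il] _; congr (_ *: _).
elim: (size env) il ab => // n IH; rewrite ltnS leq_eqVlt => /orP[/eqP->|/IH h].
  by case.
by case=> /h.
Qed.

End VectorExpressions.

Ltac vmem x l :=
  lazymatch l with
  | nil => constr:(false)
  | cons x _ => constr:(true)
  | cons _ ?t => vmem x t
  end.

Ltac vindex x l :=
  lazymatch l with
  | cons x _ => constr:(O)
  | cons _ ?t => let n := vindex x t in constr:(S n)
  end.

Ltac vatoms e l :=
  lazymatch e with
  | @GRing.zero _ => l
  | @GRing.add _ ?a ?b => let l1 := vatoms a l in vatoms b l1
  | @GRing.opp _ ?a => vatoms a l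
  | @GRing.scale _ _ _ ?a => vatoms a l
  | _ => lazymatch vmem e l with true => l | false => constr:(cons e l) end
  end.

Ltac vreify K e l :=
  lazymatch e with
  | @GRing.zero _ => constr:(@VZero K)
  | @GRing.add _ ?a ?b =>
    let a1 := vreify K a l in let b1 := vreify K b l in constr:(@VAdd K a1 b1)
  | @GRing.opp _ ?a => let a1 := vreify K a l in constr:(@VOpp K a1)
  | @GRing.scale _ _ ?r ?a => let a1 := vreify K a l in constr:(@VScale K r a1)
  | _ => let n := vindex e l in constr:(@VVar K n)
  end.

(* Reduces an equation between vectors to the equations between the
   coefficients of each atom, and tries [ring] and [lra] on these. *)
Ltac vect K W :=
  lazymatch goal with
  | |- @eq ?T ?a ?b =>
    let l0 := constr:(@nil W) in
    let l1 := vatoms a l0 in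
    let l := vatoms b l1 in
    let a1 := vreify (GRing.ComPzRing.sort K) a l in
    let b1 := vreify (GRing.ComPzRing.sort K) b l in
    apply: (@veval_eq K W l a1 b1);
    cbn [vcoefs_eq vcoef size Nat.eqb];
    repeat split; try solve [ring | lra]
  end.

(** * Norming functionals *)

Section LinearFunctionals.
Context {R : realType} {V : normedModType R}.
Variables (f : V -> R) (hf : lin_fun f).

Lemma lin_funD x y : f (x + y) = f x + f y.
Proof. by have := hf 1 x y; rewrite scale1r mul1r. Qed.

Lemma lin_fun0 : f 0 = 0.
Proof. by have := lin_funD 0 0; rewrite addr0; lra. Qed.

Lemma lin_funZ a x : f (a *: x) = a * f x.
Proof. by have := hf a x 0; rewrite lin_fun0 !addr0. Qed.

Lemma lin_funN x : f (- x) = - f x.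
Proof. by rewrite -scaleN1r lin_funZ mulN1r. Qed.

Definition lin_funE := (lin_funD, lin_funZ, lin_funN, lin_fun0).

End LinearFunctionals.

(** * Hahn-Banach through minimal sublinear functions *)

Section HahnBanach.
Context {R : realType} {V : normedModType R}.
Implicit Types (p : V -> R) (x y z : V).

(** One inequality for positive [t] suffices, since [t^-1] gives the converse. The bound by the norm
    yields [- |x| <= p x], which keeps infima over chains finite. *)
Definition sublinear_below_norm p :=
  [/\ forall x y, p (x + y) <= p x + p y,
      forall t x, 0 < t -> p (t *: x) <= t * p x
    & forall x, p x <= `|x|].

Lemma sublinear0 p : sublinear_below_norm p -> p 0 = 0.
Proof.
move=> [pD _ pn]; have := pD 0 0; have := pn 0.
by rewrite addr0 normr0 => a b; apply/eqP; rewrite eq_le a /=; lra.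
Qed.

Lemma sublinear_oppr_ge p x : sublinear_below_norm p -> - p (- x) <= p x.
Proof.
move=> hp; have [pD _ _] := hp.
by have := pD x (- x); rewrite subrr sublinear0 //; lra.
Qed.

Lemma sublinear_scale_ge p t x : sublinear_below_norm p ->
  0 <= t -> t * p x <= p (t *: x).
Proof.
move=> hp; have [_ pZ _] := hp.
rewrite le0r => /orP[/eqP->|t0]; first by rewrite mul0r scale0r sublinear0.
have := @pZ t^-1 (t *: x); rewrite invr_gt0 => /(_ t0).
by rewrite scalerA mulVf ?gt_eqF // scale1r mulrC ler_pdivlMr // mulrC.
Qed.

(** Take for [r x] the infimum of [p (x + t z) - t p z] over [t >= 0]; the choice [t = 1] bounds the
    value at [- z]. Consequently a minimal [p] is odd. *)
Lemma sublinear_reduce p z : sublinear_below_norm p ->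
  exists r, [/\ sublinear_below_norm r, forall x, r x <= p x & r (- z) <= - p z].
Proof.
move=> hp; have [pD pZ pn] := hp.
pose A x := [set p (x + t *: z) - t * p z | t in [set t : R | 0 <= t]].
have lbA x : lbound (A x) (- p (- x)).
  move=> _ [t /= t0 <-].
  have := sublinear_scale_ge z hp t0.
  have := pD (x + t *: z) (- x); rewrite addrAC subrr add0r; lra.
have A0 x : A x !=set0.
  by exists (p (x + 0 *: z) - 0 * p z), 0 => //=.
have infA x t : 0 <= t -> inf (A x) <= p (x + t *: z) - t * p z.
  by move=> t0; apply: ge_inf; [exists (- p (- x)); exact: lbA|exists t].
have infp x : inf (A x) <= p x.
  by have := infA x 0 (lexx _); rewrite scale0r addr0 mul0r subr0.
exists (fun x => inf (A x)); split => //.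
- split => [x y|s x s0|x].
  + rewrite -lerBlDr; apply: lb_le_inf => // _ [t /= t0 <-].
    rewrite lerBlDr -lerBlDl; apply: lb_le_inf => // _ [s /= s0 <-].
    have := infA (x + y) (t + s) (addr_ge0 t0 s0).
    have := pD (x + t *: z) (y + s *: z).
    have -> : x + t *: z + (y + s *: z) = x + y + (t + s) *: z by vect R V.
    lra.
  + rewrite mulrC -ler_pdivrMr //; apply: lb_le_inf => // _ [t /= t0 <-].
    rewrite ler_pdivrMr //.
    have := infA (s *: x) (s * t) (mulr_ge0 (ltW s0) t0).
    have := pZ s (x + t *: z) s0; rewrite scalerDr scalerA; lra.
  + exact: le_trans (infp x) (pn x).
- have := infA (- z) 1 ler01.
  by rewrite scale1r addNr sublinear0 // mul1r sub0r.
Qed.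

(** Zorn's lemma for the reversed pointwise order; a nonempty chain is bounded by its pointwise
    infimum. *)
Lemma sublinear_minimal p : sublinear_below_norm p ->
  exists r, [/\ sublinear_below_norm r, forall x, r x <= p x &
    forall s, sublinear_below_norm s -> (forall x, s x <= r x) -> s = r].
Proof.
move=> hp.
pose T := {r : V -> R | sublinear_below_norm r /\ forall x, r x <= p x}.
pose le (r s : T) : bool := `[< forall x, sval s x <= sval r x >].
have [||||[r [hr rp]] rmin] := @Zorn T le.
- by move=> r; apply/asboolP.
- move=> r s t /asboolP rs /asboolP st; apply/asboolP => x.
  exact: le_trans (st x) (rs x).
- move=> [r hr] [s hs] /asboolP /= rs /asboolP /= sr.
  by apply: eq_exist; apply/funext => x; apply/eqP; rewrite eq_le rs sr.
- move=> A Atot; have [[a Aa]|A0] := pselect (A !=set0); last first.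
    exists (exist _ p (conj hp (fun x => lexx _))) => s As.
    by case: A0; exists s.
  pose B x := [set sval r x | r in A].
  have lbB x : lbound (B x) (- `|x|).
    move=> _ [r Ar <-]; case: r {Ar} => r /= [hr _].
    have := sublinear_oppr_ge x hr; have [_ _ rn] := hr.
    by have := rn (- x); rewrite normrN; lra.
  have B0 x : B x !=set0 by exists (sval a x), a.
  have infB x r : A r -> inf (B x) <= sval r x.
    by move=> Ar; apply: ge_inf; [exists (- `|x|); exact: lbB|exists r].
  have infp x : inf (B x) <= p x.
    by apply: le_trans (infB x a Aa) _; case: (svalP a).
  have hB : sublinear_below_norm (fun x => inf (B x)).
    split=> [x y|t x t0|x].
    + rewrite -lerBlDr; apply: lb_le_inf => // _ [r Ar <-].
      rewrite lerBlDr -lerBlDl; apply: lb_le_inf => // _ [s As <-].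
      rewrite lerBlDl.
      (* The smaller of the two chain members is subadditive and lies below the other, so it alone
         bounds the infimum at [x + y]. *)
      have [/asboolP rs|/asboolP sr] := Atot r s Ar As.
        have [[sD _ _] _] := svalP s.
        by apply: le_trans (infB _ s As) _; apply: le_trans (sD x y) _; rewrite lerD.
      have [[rD _ _] _] := svalP r.
      by apply: le_trans (infB _ r Ar) _; apply: le_trans (rD x y) _; rewrite lerD.
    + rewrite mulrC -ler_pdivrMr //; apply: lb_le_inf => // _ [r Ar <-].
      rewrite ler_pdivrMr // mulrC; apply: le_trans (infB _ r Ar) _.
      by have [[_ rZ _] _] := svalP r; exact: rZ.
    + by apply: le_trans (infp x) _; have [_ _] := hp; exact.
  exists (exist _ (fun x => inf (B x)) (conj hB infp)) => s As.
  by apply/asboolP => x /=; exact: infB.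
exists r; split=> // s hs sr.
have sp x : s x <= p x by exact: le_trans (sr x) (rp x).
have := rmin (exist _ s (conj hs sp)).
have h : le (exist _ r (conj hr rp)) (exist _ s (conj hs sp)) by apply/asboolP.
by move=> /(_ h) [].
Qed.

(** Lowering the norm along [z] forces the value at [- z] down to [- |z|]. A minimal function below
    the result is odd, and an odd sublinear function is linear. *)
Lemma norming_functional z : exists phi : V -> R,
  [/\ lin_fun phi, forall x, `|phi x| <= `|x| & phi z = `|z|].
Proof.
have hn : sublinear_below_norm (fun x : V => `|x|).
  by split=> // [x y|t x t0]; [exact: ler_normD|rewrite normrZ gtr0_norm].
have [p0 [hp0 p0n p0z]] := sublinear_reduce z hn.
have [p [hp pp0 pmin]] := sublinear_minimal hp0.
have pN x : p (- x) = - p x.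
  have [r [hr rp rx]] := sublinear_reduce x hp.
  have := pmin r hr rp => rE; rewrite rE in rx.
  by apply/eqP; rewrite eq_le rx /= lerNl sublinear_oppr_ge.
have [pD pZ pn] := hp.
have pDE x y : p (x + y) = p x + p y.
  apply/eqP; rewrite eq_le pD /=.
  by have := pD (x + y) (- y); rewrite addrK pN; lra.
have pZE t x : p (t *: x) = t * p x.
  wlog t0 : t / 0 <= t => [H|].
    have [/H//|t0] := leP 0 t; have /H : 0 <= - t by lra.
    by rewrite scaleNr pN; lra.
  apply/eqP; rewrite eq_le sublinear_scale_ge // andbT.
  move: t0; rewrite le0r => /orP[/eqP->|/pZ//].
  by rewrite scale0r sublinear0 // mul0r.
exists p; split=> [a x y|x|]; first by rewrite pDE pZE.
  by rewrite ler_norml pn andbT lerNl -pN -[leRHS]normrN.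
apply/eqP; rewrite eq_le pn /=.
by have := pp0 (- z); rewrite pN; lra.
Qed.

End HahnBanach.

(** * Flinn elements and contractive projections *)

Section ContractivePairs.
Context {R : realType} {V : normedModType R}.
Implicit Types (f : V -> R) (u v w x y z : V).

(** The projection along [u] onto the kernel of [f] is a contraction; Flinn pairs are used below in
    this form. *)
Definition contractive_pair u f :=
  [/\ lin_fun f, f u = 1 & forall x, `|x - f x *: u| <= `|x|].

Definition birkhoff x u := forall t : R, `|x| <= `|x + t *: u|.

Lemma birkhoff_norm_ge x u a b : birkhoff x u -> `|a| * `|x| <= `|a *: x + b *: u|.
Proof.
move=> xu; have [->|a0] := eqVneq a 0; first by rewrite normr0 mul0r.
have -> : a *: x + b *: u = a *: (x + (b / a) *: u) by vect R V; field.
by rewrite normrZ ler_pM2l ?normr_gt0.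
Qed.

Lemma contractive_pair_neq0 u f : contractive_pair u f -> u != 0.
Proof.
move=> [fl fu _]; apply: contra_eq_neq fu => ->.
by rewrite (lin_fun0 fl) eq_sym oner_eq0.
Qed.

Lemma contractive_pair_bound u f y : contractive_pair u f ->
  `|f y| * `|u| <= 2 * `|y|.
Proof.
move=> [fl _ fc]; rewrite -normrZ.
have -> : f y *: u = y - (y - f y *: u) by vect R V.
by have := ler_normB y (y - f y *: u); have := fc y; lra.
Qed.

Lemma contractive_pair_birkhoff u f x : contractive_pair u f ->
  f x = 0 -> birkhoff x u.
Proof.
move=> [fl fu fc] fx t; have := fc (x + t *: u).
by rewrite !(lin_funE fl) fx fu add0r mulr1 addrK.
Qed.

Lemma dual_norm_norming f z (c : R) : 0 < `|z| ->
  (forall x, `|f x| <= c * `|x|) -> f z = c * `|z| -> lin_fun f -> 0 <= c ->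
  dual_norm f = c.
Proof.
move=> z0 fle fz fl c0; apply/eqP; rewrite eq_le; apply/andP; split.
  apply: ge_sup; first by exists `|f 0|, 0 => //=; rewrite normr0.
  move=> _ [y /= y1 <-]; apply: le_trans (fle y) _.
  by rewrite ler_piMr.
apply: ub_le_sup.
  exists c => _ [y /= y1 <-]; apply: le_trans (fle y) _.
  by rewrite ler_piMr.
exists (`|z|^-1 *: z) => /=.
  by rewrite normrZ normfV normr_id mulVf ?gt_eqF.
rewrite (lin_funZ fl) fz mulrCA mulVf ?gt_eqF // mulr1.
by rewrite ger0_norm.
Qed.

Lemma lin_fun_continuous f (c : R) : lin_fun f ->
  (forall x, `|f x| <= c * `|x|) -> continuous f.
Proof.
move=> fl fle x; apply/cvgrPdist_le => e e0.
near=> y.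
have -> : f x - f y = f (x - y) by rewrite !(lin_funE fl).
apply: le_trans (fle _) _.
have c1 : 0 < `|c| + 1 by rewrite ltr_wpDl.
apply: (@le_trans _ _ ((`|c| + 1) * `|x - y|)).
  by apply: ler_wpM2r => //; have := ler_norm c; lra.
rewrite mulrC -ler_pdivlMr //.
near: y; apply: cvgr_dist_le; first exact: cvg_id.
exact: divr_gt0.
Unshelve. all: by end_near.
Qed.

Lemma num_positive_norming (P : V -> V) z : num_positive P -> z != 0 ->
  exists phi, [/\ lin_fun phi, forall x, `|phi x| <= `|x|, phi z = `|z|
    & 0 <= phi (P z)].
Proof.
move=> [_ [_ Ppos]] z0; have [phi [phil phile phiz]] := norming_functional z.
exists phi; split => //.
have zgt0 : 0 < `|z| by rewrite normr_gt0.
(* Numerical positivity speaks of functionals of norm [|z|], hence the rescaling. *)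
pose psi x := `|z| * phi x.
have psil : lin_fun psi by move=> a x y; rewrite /psi phil; ring.
have psile x : `|psi x| <= `|z| * `|x|.
  by rewrite /psi normrM normr_id ler_pM2l.
have psiz : psi z = `|z| * `|z| by rewrite /psi phiz.
have := Ppos z psi (conj psil (lin_fun_continuous psil psile)).
rewrite (dual_norm_norming zgt0 psile psiz psil (ltW zgt0)) => /(_ erefl).
by rewrite psiz expr2 => /(_ erefl); rewrite /psi pmulr_rge0.
Qed.

(** Suppose [|y + t u| < |y|] with [f y = 0]. A point [z = y + la t u] close enough to [y] is still
    longer than [y + t u]. A functional [phi] norming [z] has [t phi u >= 0] by positivity, so its
    value at [y + t u] is at least [|z|], a contradiction. *)
Lemma flinn_contractive u : u != 0 -> flinn u -> exists f, contractive_pair u f.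
Proof.
move=> u0 [P [Ppos [PP Pran]]]; have [Pl _] := Ppos.
have Pex x : exists r, P x = r *: u.
  have : range P (P x) by exists x.
  by rewrite Pran => -[r _ rE]; exists r.
pose f x := sval (cid (Pex x)).
have PE x : P x = f x *: u by exact: svalP (cid (Pex x)).
have uinj a b : a *: u = b *: u -> a = b.
  move=> /eqP; rewrite -subr_eq0 -scalerBl scaler_eq0 (negPf u0) orbF subr_eq0.
  by move/eqP.
have fl : lin_fun f.
  move=> a x y; apply: uinj.
  by rewrite -PE Pl !PE scalerA -scalerDl.
have fu : f u = 1.
  have : range P u by rewrite Pran; exists 1 => //; rewrite scale1r.
  by move=> [x _ xu]; apply: uinj; rewrite -PE -xu PP scale1r.
exists f; split => // x.
set y := x - f x *: u.
have fy : f y = 0 by rewrite /y !(lin_funE fl) fu; ring.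
have -> : x = y + f x *: u by rewrite /y; vect R V.
move: (f x) => t; clearbody y; rewrite leNgt; apply/negP => lt_t.
have ugt0 : 0 < `|u| by rewrite normr_gt0.
have t0 : t != 0 by apply: contraTneq lt_t => ->; rewrite scale0r addr0 ltxx.
have tgt0 : 0 < `|t| by rewrite normr_gt0.
pose d := `|y| - `|y + t *: u|.
have d0 : 0 < d by rewrite /d subr_gt0.
(* The choice serves to have [0 < la < 1] and [la |t| |u| < d]. *)
pose la := d / (d + `|t| * `|u| + d).
have tu0 : 0 < `|t| * `|u| by exact: mulr_gt0.
have la0 : 0 < la by apply: divr_gt0 => //; lra.
have la1 : la < 1 by rewrite /la ltr_pdivrMr; lra.
have lad : la * (`|t| * `|u|) < d.
  by rewrite /la mulrAC ltr_pdivrMr; [nra|lra].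
pose z := y + (la * t) *: u.
have zt : `|y + t *: u| < `|z|.
  have := ler_normB z ((la * t) *: u).
  rewrite {1}/z addrK normrZ normrM (gtr0_norm la0) -mulrA.
  by rewrite /d in lad; lra.
have z0 : z != 0 by rewrite -normr_gt0; apply: le_lt_trans zt.
have [phi [phil phile phiz]] := num_positive_norming Ppos z0.
have fz : f z = la * t by rewrite /z !(lin_funE fl) fy fu; ring.
rewrite PE (lin_funZ phil) fz.
have phiyt : phi (y + t *: u) <= `|y + t *: u|.
  by apply: le_trans (ler_norm _) (phile _).
have : phi (y + t *: u) = phi z + (1 - la) * (t * phi u).
  by rewrite /z !(lin_funE phil); ring.
rewrite phiz => e1 h.
have h1 : 0 <= t * phi u.
  by move: h; rewrite -mulrA pmulr_rge0.
have h2 : 0 <= (1 - la) * (t * phi u) by apply: mulr_ge0 => //; lra.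
by move: zt; rewrite ltNge => /negP; apply; apply: le_trans phiyt; rewrite e1 lerDl.
Qed.

Lemma dim_ge3_notin_span u v : dim_ge3 V ->
  exists z, forall a b, z <> a *: u + b *: v.
Proof.
move=> [x1 [x2 [x3 xfree]]]; apply: contrapT => /forallNP nz.
have xs x : exists ab : R * R, x = ab.1 *: u + ab.2 *: v.
  have /existsNP[a /existsNP[b /contrapT xE]] := nz x.
  by exists (a, b).
have [[a1 b1] /= e1] := xs x1; have [[a2 b2] /= e2] := xs x2.
have [[a3 b3] /= e3] := xs x3.
have h c1 c2 c3 : c1 * a1 + c2 * a2 + c3 * a3 = 0 ->
    c1 * b1 + c2 * b2 + c3 * b3 = 0 -> [/\ c1 = 0, c2 = 0 & c3 = 0].
  move=> ea eb; apply: xfree; rewrite e1 e2 e3.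
  transitivity ((c1 * a1 + c2 * a2 + c3 * a3) *: u +
                (c1 * b1 + c2 * b2 + c3 * b3) *: v); first by vect R V.
  by rewrite ea eb !scale0r addr0.
(* The coefficients form the cross product of the rows [a] and [b], which is orthogonal to both. *)
have [h1 h2 h3] : [/\ a2 * b3 - a3 * b2 = 0, a3 * b1 - a1 * b3 = 0
    & a1 * b2 - a2 * b1 = 0] by apply: h; ring.
have [a20 /eqP + _] : [/\ a2 = 0, - a1 = 0 & (0 : R) = 0] by apply: h; lra.
rewrite oppr_eq0 => /eqP a10.
have [b20 /eqP + _] : [/\ b2 = 0, - b1 = 0 & (0 : R) = 0] by apply: h; lra.
rewrite oppr_eq0 => /eqP b10.
have [/eqP + _ _] : [/\ (1 : R) = 0, (0 : R) = 0 & (0 : R) = 0].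
  by apply: h; rewrite ?a10 ?b10; ring.
by rewrite oner_eq0.
Qed.

End ContractivePairs.

(** * Uniqueness of the contractive functional *)

Section Exposed.
Context {R : realType} {V : normedModType R}.
Implicit Types (m k x v : V).

Lemma norm_line_continuous m k : continuous (fun t : R => `|m + t *: k|).
Proof.
move=> t; apply: cvg_norm; apply: cvgD; first exact: cvg_cst.
exact: scalel_continuous.
Qed.

(* The point is where the ratio of a Euclidean norm of the plane to the given
   norm is maximal along the line, and v is the Euclidean tangent there. *)
Lemma exposed_point m k : k != 0 -> (forall t : R, m + t *: k != 0) ->
  exists t c : R, forall s : R, s != 0 ->
    `|m + t *: k| < `|m + t *: k + s *: (c *: m + k)|.
Proof.
move=> k0 mk0.
have kgt0 : 0 < `|k| by rewrite normr_gt0.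
have mgt0 : 0 < `|m| by have := mk0 0; rewrite scale0r addr0 normr_gt0.
have Dgt0 t : 0 < `|m + t *: k| by rewrite normr_gt0.
(* With this [A] the ratio [F] below has at infinity the limit [A / |k|^2], half of [F 0], so its
   maximum over the line is attained; beyond [T] it is already at most [F 0]. *)
pose A : R := `|k| ^+ 2 / (2 * `|m| ^+ 2).
have k2 : 0 < `|k| ^+ 2 by exact: exprn_gt0.
have m2 : 0 < `|m| ^+ 2 by exact: exprn_gt0.
have D2 t : 0 < `|m + t *: k| ^+ 2 by exact: exprn_gt0.
have A0 : 0 < A by apply: divr_gt0 => //; lra.
have AE : A * (2 * `|m| ^+ 2) = `|k| ^+ 2 by rewrite /A; field; rewrite gt_eqF.
pose F t : R := (1 + A * t ^+ 2) / `|m + t *: k| ^+ 2.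
have Fc : continuous F.
  move=> t; apply: cvgM.
    apply: cvgD; first exact: cvg_cst.
    apply: cvgM; first exact: cvg_cst.
    by apply: cvgM; exact: cvg_id.
  apply: cvgV; first by rewrite gt_eqF.
  by apply: cvgM; exact: norm_line_continuous.
pose T := 4 * `|m| / `|k|.
have T0 : 0 < T by apply: divr_gt0 => //; lra.
have TE : T * `|k| = 4 * `|m| by rewrite /T; field; rewrite gt_eqF.
have [t0 t0T Fmax] : exists2 c, c \in `[- T, T]%R &
    forall t, t \in `[- T, T]%R -> F t <= F c.
  apply: EVT_max; first lra.
  by apply: continuous_subspaceT => t; exact: Fc.
have F0 : F 0 = (`|m| ^+ 2)^-1.
  by rewrite /F scale0r addr0 expr0n mulr0 addr0 mul1r.
have F0le : F 0 <= F t0 by apply: Fmax; rewrite in_itv /=; apply/andP; split; lra.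
have Fle t : F t <= F t0.
  have [tT|tT] := boolP (t \in `[- T, T]%R); first exact: Fmax.
  apply: le_trans F0le; rewrite F0 /F ler_pdivrMr // [leRHS]mulrC.
  rewrite ler_pdivlMr //.
  have tgeT : T <= `|t|.
    rewrite leNgt; apply/negP => /ltW; rewrite ler_norml => tT'.
    by move: tT; rewrite in_itv /= tT'.
  have := ler_normB (m + t *: k) m; rewrite addrAC subrr add0r normrZ => tri.
  have tk : 4 * `|m| <= `|t| * `|k| by rewrite -TE ler_pM2r.
  have sq : (`|t| * `|k| - `|m|) ^+ 2 <= `|m + t *: k| ^+ 2.
    by rewrite ler_sqr ?nnegrE; lra.
  have e1 : (1 + A * t ^+ 2) * `|m| ^+ 2 = `|m| ^+ 2 + (`|t| * `|k|) ^+ 2 / 2.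
    by rewrite exprMn (real_normK (num_real t)) -AE; field.
  rewrite e1; apply: le_trans sq; nra.
(* Homogeneity extends the maximality of [F t0] from the line to the whole plane. *)
have Aphi (b a : R) : b ^+ 2 + A * a ^+ 2 <= F t0 * `|b *: m + a *: k| ^+ 2.
  have [->|b0] := eqVneq b 0.
    rewrite scale0r add0r normrZ exprMn (real_normK (num_real a)) expr0n /= add0r.
    rewrite [leLHS]mulrC [leRHS]mulrCA ler_wpM2l ?sqr_ge0 //.
    apply: le_trans (_ : F 0 * `|k| ^+ 2 <= _); last by rewrite ler_pM2r.
    rewrite F0 -AE (_ : _^-1 * _ = 2 * A); first by lra.
    by field; rewrite gt_eqF.
  have -> : b *: m + a *: k = b *: (m + (a / b) *: k) by vect R V; field.
  rewrite normrZ exprMn (real_normK (num_real b)).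
  have := Fle (a / b); rewrite {1}/F ler_pdivrMr // => h.
  have -> : b ^+ 2 + A * a ^+ 2 = b ^+ 2 * (1 + A * (a / b) ^+ 2) by field.
  by rewrite [leRHS]mulrCA ler_pM2l // exprn_even_gt0.
have Ft0 : F t0 * `|m + t0 *: k| ^+ 2 = 1 + A * t0 ^+ 2.
  by rewrite /F; field; rewrite gt_eqF.
have Fpos : 0 < F t0 by apply: lt_le_trans F0le; rewrite F0 invr_gt0.
(* This makes [c m + k] orthogonal to [m + t0 k] for the form [b^2 + A a^2]. *)
exists t0, (- A * t0) => s s0.
have -> : m + t0 *: k + s *: ((- A * t0) *: m + k) =
    (1 - s * A * t0) *: m + (t0 + s) *: k by vect R V.
rewrite -ltr_sqr ?nnegrE // -(ltr_pM2l Fpos) Ft0.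
apply: lt_le_trans (Aphi _ _).
have s2 : 0 < s ^+ 2 by rewrite exprn_even_gt0.
have -> : (1 - s * A * t0) ^+ 2 + A * (t0 + s) ^+ 2 =
   1 + A * t0 ^+ 2 + s ^+ 2 * (A ^+ 2 * t0 ^+ 2 + A) by ring.
rewrite ltrDl mulr_gt0 // ltr_wpDl // mulr_ge0 ?sqr_ge0 //.
Qed.

End Exposed.

(** Bounded intervals are compact, and a cluster point of an ultrafilter is a limit. A family of
    functionals thus converges at all vectors along one filter. *)
Lemma ultrafilter_cvg {R : realType} (T : Type) (U : set_system T) (g : T -> R)
    (C : R) : UltraFilter U -> (\forall i \near U, `|g i| <= C) ->
  exists l : R, g @ U --> l.
Proof.
move=> UU gC; have [] := @segment_compact R (- C) C (g @ U).
  by near=> i; rewrite /= in_itv /= -ler_norml; near: i.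
move=> l [_ cl]; exists l => B lB.
have [//|nB] := in_ultra_setVsetC (g @^-1` B) UU.
by have [y [/[apply]]] := cl (~` B) B nB lB.
Unshelve. all: by end_near.
Qed.

Section Uniqueness.
Context {R : realType} {V : normedModType R}.
Hypothesis dim3 : dim_ge3 V.
Hypothesis pairs : forall u : V, u != 0 -> exists f, contractive_pair u f.
Implicit Types (f g h : V -> R) (u v w x y z : V).

(* If f and g differ, choose x exposed in a plane inside ker f on which f - g
   is not zero.  Both x and x + w have norm at most |x|; projecting them along
   w + e v and then along w moves x by a multiple of v, so exposedness forces
   the functional of w + e v to vanish at w, which is absurd for small e. *)
Lemma contractive_pair_unique w f g : contractive_pair w f ->
  contractive_pair w g -> f =1 g.
Proof.
move=> fP gP; apply: contrapT => /existsNP[m0 /eqP fg].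
have [[fl fw fc] [gl gw gc]] := (fP, gP).
have w0 := contractive_pair_neq0 fP.
pose d y := f y - g y.
have dl : lin_fun d by move=> a x y; rewrite /d fl gl; ring.
have dw : d w = 0 by rewrite /d fw gw subrr.
have dm0 : d m0 != 0 by rewrite subr_eq0.
(* In the plane of [m] and the later [k], inside the kernel of [f], the line [m + t k] is the level
   set [d = 1]. *)
pose m := (d m0)^-1 *: (m0 - f m0 *: w).
have fm : f m = 0 by rewrite /m !(lin_funE fl) fw; ring.
have dm : d m = 1 by rewrite /m !(lin_funE dl) dw; field.
clearbody m; have [z zE] := dim_ge3_notin_span w m dim3.
pose k := z - f z *: w - d z *: m.
have fk : f k = 0 by rewrite /k !(lin_funE fl) fw fm; ring.
have dk : d k = 0 by rewrite /k !(lin_funE dl) dw dm; ring.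
have k0 : k != 0.
  apply/eqP => k0; case: (zE (f z) (d z)).
  transitivity (k + f z *: w + d z *: m); first by rewrite /k; vect R V.
  by rewrite k0 add0r.
clearbody k; have mk0 t : m + t *: k != 0.
  apply/eqP => /(congr1 d); rewrite !(lin_funE dl) dm dk => /eqP.
  by rewrite mulr0 addr0 oner_eq0.
have [t [c xexp]] := exposed_point k0 mk0.
move: xexp; set x := m + t *: k; set v := c *: m + k => xexp.
have fx : f x = 0 by rewrite /x !(lin_funE fl) fm fk; ring.
have dx : d x = 1 by rewrite /x !(lin_funE dl) dm dk; ring.
have fv : f v = 0 by rewrite /v !(lin_funE fl) fm fk; ring.
have xw : `|x + w| <= `|x|.
  have := gc x; have -> : g x = -1 by move: dx; rewrite /d fx; lra.
  by rewrite scaleN1r opprK.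
clearbody x v; clear mk0 k0 fk dk zE k z fm dm m dm0 t c.
have v0 : v != 0.
  by apply: contraTneq (xexp 1 (oner_neq0 _)) => ->; rewrite scaler0 addr0 ltxx.
have vgt0 : 0 < `|v| by rewrite normr_gt0.
have wgt0 : 0 < `|w| by rewrite normr_gt0.
(* Then [w + e v] keeps three quarters of the length of [w], and the bound on [h v] contradicts
   [e h v = 1] at the end. *)
pose e := `|w| / (4 * `|v|).
have e0 : 0 < e by apply: divr_gt0 => //; lra.
have ev : e * `|v| = `|w| / 4 by rewrite /e; field; rewrite gt_eqF.
have wev : 3 / 4 * `|w| <= `|w + e *: v|.
  have := ler_normB (w + e *: v) (e *: v).
  by rewrite addrK normrZ (gtr0_norm e0) ev; lra.
have wev0 : w + e *: v != 0 by rewrite -normr_gt0; lra.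
have [h hP] := pairs wev0.
have [hl hwev hc] := hP.
(* The two projections send [x + s w] to [x - e h(x + s w) v]. *)
have key s : `|x + s *: w| <= `|x| -> h (x + s *: w) = 0.
  move=> xs; apply/eqP/negPn/negP => hn.
  have /xexp : - (h (x + s *: w) * e) != 0.
    by rewrite oppr_eq0 mulf_neq0 // gt_eqF.
  apply/negP; rewrite -leNgt; apply: le_trans xs; apply: le_trans (hc _).
  apply: le_trans (fc _); rewrite le_eqVlt; apply/orP; left; apply/eqP; congr (`|_|).
  rewrite !(lin_funE fl) fx fw fv; vect R V.
have h0 := key 0; rewrite scale0r addr0 lexx in h0.
have h1 := key 1; rewrite scale1r (lin_funD hl) h0 // add0r in h1.
have hv : e * h v = 1.
  by rewrite -hwev !(lin_funE hl) h1 // add0r.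
have := contractive_pair_bound v hP.
have : 1 <= e * `|h v|.
  by rewrite -[leLHS]normr1 -hv normrM (gtr0_norm e0).
nra.
Qed.

(** Let [e] decrease to 0. The functionals of [u + e x] are uniformly bounded, so along an
    ultrafilter they converge to a contractive functional of [u], which is [f] by uniqueness. Each
    is nonnegative at [x]: with a negative value its projection would lengthen [x]. *)
Lemma birkhoff_contractive_ge0 u f x : contractive_pair u f ->
  birkhoff x u -> 0 <= f x.
Proof.
move=> fP xu; have u0 := contractive_pair_neq0 fP.
have ugt0 : 0 < `|u| by rewrite normr_gt0.
have [->|x0] := eqVneq x 0; first by case: fP => fl _ _; rewrite (lin_fun0 fl).
have xgt0 : 0 < `|x| by rewrite normr_gt0.
have /choice[F FP] : forall e : R, exists h : V -> R, u + e *: x != 0 ->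
    contractive_pair (u + e *: x) h.
  move=> e.
  have [n0|_] := boolP (u + e *: x != 0); last by exists (fun=> 0).
  by have [h hP] := pairs n0; exists h.
have [U [UU sU]] := ultraFilterLemma (at_right_proper_filter (0 : R)).
have Unear (P : R -> Prop) : (\forall e \near 0^'+, P e) -> \forall e \near U, P e.
  exact: sU.
(* This keeps [|u + e x| >= |u| / 2], whence a bound on [F e y] uniform in [e]. *)
have Ue : \forall e \near U, 0 < e /\ e * `|x| <= `|u| / 2.
  apply: Unear; near=> e; split => //.
  by rewrite -ler_pdivlMr //; near: e; apply: nbhs_right_le; rewrite !divr_gt0.
have UP : \forall e \near U, [/\ 0 < e, e * `|x| <= `|u| / 2 & u + e *: x != 0].
  near=> e.
  have [e0 ex] : 0 < e /\ e * `|x| <= `|u| / 2 by near: e.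
  split => //; rewrite -normr_gt0.
  have := ler_normB (u + e *: x) (e *: x).
  by rewrite addrK normrZ (gtr0_norm e0); lra.
have Fbound e y : 0 < e -> e * `|x| <= `|u| / 2 -> u + e *: x != 0 ->
    `|F e y| <= 4 * `|y| / `|u|.
  move=> e0 ex n0; have := contractive_pair_bound y (FP e n0).
  have := ler_normB (u + e *: x) (e *: x).
  rewrite addrK normrZ (gtr0_norm e0) ler_pdivlMr //.
  have := normr_ge0 (F e y); nra.
have Flim y : exists l : R, F e y @[e --> U] --> l.
  apply: (@ultrafilter_cvg _ _ _ _ (4 * `|y| / `|u|)).
  near=> e.
  have [e0 ex n0] : [/\ 0 < e, e * `|x| <= `|u| / 2 & u + e *: x != 0] by near: e.
  exact: Fbound.
have [l lP] := choice Flim.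
have Uid : e @[e --> U] --> (0 : R).
  apply: cvg_trans sU _ => /=; first exact: cvg_at_right_filter cvg_id.
have gP : contractive_pair u l.
  split=> [a y z||y].
  - apply: (cvg_unique _ (lP (a *: y + z))) => //.
    have : a * F e y + F e z @[e --> U] --> a * l y + l z.
      apply: cvgD; last exact: lP.
      by apply: cvgM; [exact: cvg_cst|exact: lP].
    apply: cvg_trans; apply: near_eq_cvg; near=> e.
    have [_ _ n0] : [/\ 0 < e, e * `|x| <= `|u| / 2 & u + e *: x != 0] by near: e.
    by have [El _ _] := FP e n0; rewrite El.
  - apply: (cvg_unique _ (lP u)) => //.
    have : 1 - e * F e x @[e --> U] --> 1 - 0 * l x.
      apply: cvgB; first exact: cvg_cst.
      by apply: cvgM; [exact: Uid|exact: lP].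
    rewrite mul0r subr0; apply: cvg_trans; apply: near_eq_cvg; near=> e.
    have [_ _ n0] : [/\ 0 < e, e * `|x| <= `|u| / 2 & u + e *: x != 0] by near: e.
    by have [El <- _] := FP e n0; rewrite !(lin_funE El) addrK.
  - have : `|y - F e y *: (u + e *: x)| @[e --> U] --> `|y - l y *: (u + 0 *: x)|.
      apply: cvg_norm; apply: cvgB; first exact: cvg_cst.
      apply: cvgZ; first exact: lP.
      apply: cvgD; first exact: cvg_cst.
      by apply: cvgZr_tmp; exact: Uid.
    rewrite scale0r addr0 => /cvgr_to_le; apply; near=> e.
    have [_ _ n0] : [/\ 0 < e, e * `|x| <= `|u| / 2 & u + e *: x != 0] by near: e.
    by have [_ _] := FP e n0; exact.
rewrite (contractive_pair_unique fP gP); apply: (cvgr_to_ge (lP x)); near=> e.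
have [e0 _ n0] : [/\ 0 < e, e * `|x| <= `|u| / 2 & u + e *: x != 0] by near: e.
have [_ _ /(_ x)] := FP e n0; move: (F e x) => c xc.
rewrite leNgt; apply/negP => c0; move: xc; apply/negP; rewrite -ltNge.
have -> : x - c *: (u + e *: x) = (1 - c * e) *: x + (- c) *: u by vect R V.
apply: lt_le_trans (birkhoff_norm_ge _ _ xu).
have ce : c * e < 0 by rewrite nmulr_rlt0.
by rewrite gtr0_norm ?ltr_pMl //; lra.
Unshelve. all: by end_near.
Qed.

Lemma birkhoff_contractive u f x : contractive_pair u f ->
  birkhoff x u <-> f x = 0.
Proof.
move=> fP; split; last exact: contractive_pair_birkhoff.
move=> xu; have [fl _ _] := fP.
have := birkhoff_contractive_ge0 fP xu.
have : birkhoff (- x) u.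
  by move=> t; rewrite normrN -[leRHS]normrN opprD opprK -scaleNr; exact: xu.
by move/(birkhoff_contractive_ge0 fP); rewrite (lin_funN fl); lra.
Qed.

End Uniqueness.

(** * The duality u |-> F u preserves linear dependence *)

Section Duality.
Context {R : realType} {V : normedModType R}.
Implicit Types (f g h : V -> R) (u v w x y z : V).

Definition free2 u v := forall a b : R, a *: u + b *: v = 0 -> a = 0 /\ b = 0.

Lemma free2C u v : free2 u v -> free2 v u.
Proof. by move=> uv a b; rewrite addrC => /uv[]. Qed.

Lemma free2_neq0 u v : free2 u v -> u != 0.
Proof.
move=> uv; apply/eqP => u0; have [|/eqP] := uv 1 0.
  by rewrite u0 scaler0 scale0r addr0.
by rewrite oner_eq0.
Qed.

Lemma free2_span_kernel f u v : lin_fun f -> free2 u v ->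
  exists a b : R, a *: u + b *: v != 0 /\ f (a *: u + b *: v) = 0.
Proof.
move=> fl uv; have [fu|fu] := eqVneq (f u) 0.
  exists 1, 0; rewrite scale1r scale0r addr0; split=> //; exact: free2_neq0 uv.
exists (f v), (- f u); split; last by rewrite !(lin_funE fl); ring.
by apply/eqP => /uv[_ /eqP]; rewrite oppr_eq0 (negPf fu).
Qed.

Hypothesis dim3 : dim_ge3 V.
Variable F : V -> V -> R.
Hypothesis Fpair : forall u, u != 0 -> contractive_pair u (F u).

Let Flin u : u != 0 -> lin_fun (F u).
Proof. by move=> /Fpair[]. Qed.

Let Fid u : u != 0 -> F u u = 1.
Proof. by move=> /Fpair[]. Qed.

Let Fpairs u : u != 0 -> exists f, contractive_pair u f.
Proof. by move=> u0; exists (F u); exact: Fpair. Qed.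

Let Fbirkhoff u x : u != 0 -> birkhoff x u <-> F u x = 0.
Proof. by move=> u0; exact: birkhoff_contractive (Fpair u0). Qed.

Lemma dualityZ (a : R) u x : a != 0 -> u != 0 -> F (a *: u) x = a^-1 * F u x.
Proof.
move=> a0 u0; have au0 : a *: u != 0 by rewrite scaler_eq0 negb_or a0.
apply: (contractive_pair_unique dim3 Fpairs (Fpair au0) (g := fun x => a^-1 * F u x)).
have [ul uu uc] := Fpair u0; split=> [b y z||y].
- by rewrite ul; ring.
- by rewrite (lin_funZ ul) uu mulr1 mulVf.
- by rewrite scalerA (_ : a^-1 * F u y * a = F u y) //; field.
Qed.

(** Projecting along [u] and then along [v] sends [x + t (a u + b v)] first to [x + t b v], then to
    [x]. *)
Lemma duality_orth_span u v x (a b : R) : u != 0 -> v != 0 -> F u v = 0 ->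
  F u x = 0 -> F v x = 0 -> a *: u + b *: v != 0 -> F (a *: u + b *: v) x = 0.
Proof.
move=> u0 v0 uv ux vx w0; apply/(Fbirkhoff _ w0) => t.
have [ul uu uc] := Fpair u0; have [vl vv vc] := Fpair v0.
apply: le_trans (uc _).
rewrite !(lin_funE ul) ux uu uv.
have -> : x + t *: (a *: u + b *: v) - (0 + t * (a * 1 + b * 0)) *: u =
  x + (t * b) *: v by vect R V.
apply: le_trans (vc _); rewrite !(lin_funE vl) vx vv.
by rewrite add0r mulr1 addrK.
Qed.

(** With [z' = z + e (v - u)], the vector [w = u - e^-1 z] equals [v - e^-1 z'], so it lies in the
    span of [u, z] and in that of [v, z']. By [duality_orth_span], [F z] and [F z'] both have the
    kernel of [F w] on the plane of [v - u] and [z]. A small [e] makes [w] too long for [F w u = 1],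
    which ensures [F w z != 0]. *)
Lemma duality_step u v z y (e al be : R) : u != 0 -> v != 0 -> F u =1 F v ->
  F u z = 0 -> e != 0 -> z + e *: (v - u) != 0 -> 3 * `|u| * `|e| < `|z| ->
  y = al *: (v - u) + be *: z -> F z y = 0 -> F (z + e *: (v - u)) y = 0.
Proof.
move=> u0 v0 uv uz e0 z'0 eu.
have z0 : z != 0.
  by rewrite -normr_gt0; apply: le_lt_trans eu; rewrite !mulr_ge0.
have [ul uu _] := Fpair u0; have [zl zz _] := Fpair z0.
set d := v - u; have ud : F u d = 0 by rewrite /d !(lin_funE ul) uu uv Fid // subrr.
have vE : v = u + d by rewrite /d; vect R V.
clearbody d; move: z'0; rewrite (_ : v - u = d); last by rewrite vE; vect R V.
move z'E : (z + e *: d) => z' z'0.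
have [z'l z'z' _] := Fpair z'0.
have uz' : F u z' = 0 by rewrite -z'E !(lin_funE ul) uz ud; ring.
have [w wu wv] : exists2 w, w = u + (- e^-1) *: z & w = v + (- e^-1) *: z'.
  by exists (u + (- e^-1) *: z) => //; rewrite vE -z'E; vect R V; field.
have ew : 2 * `|u| < `|w|.
  have := ler_normB w u; rewrite {1}wu addrAC subrr add0r normrZ normrN normfV.
  have : 3 * `|u| < `|e|^-1 * `|z|.
    by rewrite [ltRHS]mulrC ltr_pdivlMr ?normr_gt0.
  lra.
have w0 : w != 0 by rewrite -normr_gt0; apply: le_lt_trans ew; rewrite mulr_ge0.
have [wl ww _] := Fpair w0.
move=> yE zy.
have e1 : F w d = F z d * F w z.
  suff : F w (d - F z d *: z) = 0 by rewrite !(lin_funE wl); lra.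
  have := @duality_orth_span u z (d - F z d *: z) 1 (- e^-1).
  rewrite scale1r -wu; apply => //.
    by rewrite !(lin_funE ul) ud uz; ring.
  by rewrite !(lin_funE zl) zz; ring.
have e2 : F w d = F z' d * (F w z + e * F w d).
  suff : F w (d - F z' d *: z') = 0 by rewrite -{2}z'E !(lin_funE wl); lra.
  have := @duality_orth_span v z' (d - F z' d *: z') 1 (- e^-1).
  rewrite scale1r -wv -!uv; apply => //.
    by rewrite !(lin_funE ul) ud uz'; ring.
  by rewrite !(lin_funE z'l) z'z'; ring.
have wz : F w z != 0.
  apply/eqP => wz.
  have wu1 : F w u = 1 by move: ww; rewrite {2}wu !(lin_funE wl) wz; lra.
  by have := contractive_pair_bound u (Fpair w0); rewrite wu1 normr1; lra.
have e3 : F z' z = 1 - e * F z' d.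
  by move: z'z'; rewrite -{2}z'E !(lin_funE z'l); lra.
have beE : be = - (al * F z d).
  by move: zy; rewrite yE !(lin_funE zl) zz; lra.
rewrite yE !(lin_funE z'l) e3 beE; apply/eqP.
rewrite -(inj_eq (mulIf wz)) mul0r; apply/eqP.
move: e1 e2; move: (F w d) (F w z) (F z d) (F z' d) => p q r s -> e2.
have -> : (al * s + - (al * r) * (1 - e * s)) * q =
  - al * (r * q - s * (q + e * (r * q))) by ring.
by rewrite -e2 subrr mulr0.
Qed.

(* If u and v have the same functional, the steps above rotate z through all
   directions z + t (v - u) without moving the kernel of F z in their plane. *)
Lemma duality_inj u v : u != 0 -> v != 0 -> F u =1 F v -> u = v.
Proof.
move=> u0 v0 uv; apply: contrapT => uNv.
have [ul uu _] := Fpair u0.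
pose d := v - u.
have d0 : d != 0 by rewrite subr_eq0; apply/eqP => vu; apply: uNv.
have ud : F u d = 0 by rewrite /d !(lin_funE ul) uu uv Fid // subrr.
have vu : v - u = d by [].
clearbody d; have [z1 z1E] := dim_ge3_notin_span u d dim3.
pose z := z1 - F u z1 *: u.
have uz : F u z = 0 by rewrite /z !(lin_funE ul) uu; ring.
have zd (a : R) : z != a *: d.
  apply/eqP => zE; case: (z1E (F u z1) a).
  by rewrite -zE /z; vect R V.
clearbody z; clear z1E z1.
have ztd (t : R) : z + t *: d != 0.
  apply/eqP => h; have /eqP := zd (- t); apply; rewrite -[LHS]subr0 -h.
  by vect R V.
have dgt0 : 0 < `|d| by rewrite normr_gt0.
have ugt0 : 0 < `|u| by rewrite normr_gt0.
have z0 : z != 0 by have := ztd 0; rewrite scale0r addr0.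
have zgt0 : 0 < `|z| by rewrite normr_gt0.
have [dl dd dc] := Fpair d0; have [zl zz _] := Fpair z0.
(* This is the distance from [z] to the line spanned by [d], so one step length is admissible all
   along [z + t d]. *)
pose rho := `|z - F d z *: d|.
have rho0 : 0 < rho by rewrite normr_gt0 subr_eq0.
have rhole (t : R) : rho <= `|z + t *: d|.
  apply: le_trans (dc _); rewrite !(lin_funE dl) dd /rho.
  by rewrite (_ : z + _ - _ = z - F d z *: d) //; vect R V.
pose y := d - F z d *: z.
have Fy (t : R) : F (z + t *: d) y = 0.
  have [->|t0] := eqVneq t 0.
    by rewrite scale0r addr0 /y !(lin_funE zl) zz; ring.
  pose n := (Num.bound (3 * `|u| * `|t| / rho)).+1.
  have nE : 3 * `|u| * `|t| < n%:R * rho.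
    rewrite -ltr_pdivrMr //; apply: lt_trans (archi_boundP _) _.
      by apply: divr_ge0; [rewrite !mulr_ge0|exact: ltW].
    by rewrite ltr_nat.
  have ngt0 : 0 < n%:R :> R by rewrite ltr0n.
  pose e := t / n%:R.
  have e0 : e != 0 by rewrite mulf_neq0 // invr_neq0 // gt_eqF.
  have esmall : 3 * `|u| * `|e| < rho.
    rewrite /e normrM normfV (gtr0_norm ngt0) mulrA ltr_pdivrMr //.
    by rewrite [ltRHS]mulrC.
  suff H i : F (z + (i%:R * e) *: d) y = 0.
    by have := H n; rewrite /e mulrCA mulfV ?mulr1 // gt_eqF.
  elim: i => [|i IH].
    by rewrite mul0r scale0r addr0 /y !(lin_funE zl) zz; ring.
  have -> : z + (i.+1%:R * e) *: d = z + (i%:R * e) *: d + e *: (v - u).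
    by rewrite vu -natr1; vect R V.
  pose be := - F z d.
  apply: (@duality_step u v _ y e (1 - be * (i%:R * e)) be) => //.
  - by rewrite !(lin_funE ul) uz ud; ring.
  - rewrite vu (_ : _ + _ + _ = z + (i%:R * e + e) *: d) //; vect R V.
  - exact: lt_le_trans esmall (rhole _).
  - by rewrite /y vu /be; vect R V.
(* If [F z d = 0] then [y = d] and [F (z + t d) z = 1] for every [t], against the bound when
   [z + t d] is long. Otherwise some [z + t d] is a multiple of [y], at which its own functional
   vanishes. *)
have [c0|c0] := eqVneq (F z d) 0.
  pose t := 4 * `|z| / `|d|.
  have [tl tt _] := Fpair (ztd t).
  have := Fy t; rewrite /y c0 scale0r subr0 => td.
  have tz : F (z + t *: d) z = 1 by move: tt; rewrite (lin_funD tl) (lin_funZ tl) td; lra.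
  have := contractive_pair_bound z (Fpair (ztd t)); rewrite tz normr1 mul1r.
  have := ler_normB (z + t *: d) z; rewrite addrAC subrr add0r normrZ.
  rewrite ger0_norm; last by apply: divr_ge0; [rewrite mulr_ge0|].
  by rewrite /t divfK ?gt_eqF //; lra.
pose t := - (F z d)^-1.
have := Fid (ztd t).
have tE : z + t *: d = t *: y by rewrite /y /t; vect R V; field.
by rewrite {2}tE (lin_funZ (Flin (ztd t))) Fy mulr0 => /esym/eqP; rewrite oner_eq0.
Qed.

Lemma duality_parallel u v (c : R) : u != 0 -> v != 0 ->
  (forall x, F v x = c * F u x) -> c != 0 /\ c *: v = u.
Proof.
move=> u0 v0 vu.
have c0 : c != 0.
  apply/eqP => c0; have := vu v; rewrite c0 mul0r Fid // => /eqP.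
  by rewrite oner_eq0.
split => //; apply: duality_inj => //; first by rewrite scaler_eq0 negb_or c0.
by move=> x; rewrite dualityZ // vu mulKf.
Qed.

(** The vectors [u - F v u *: v] and [v] are dual to [F u] and [F v]; what remains of [x] lies in
    both kernels, hence in that of [F w]. *)
Lemma duality_comb_orth u v (a b : R) : u != 0 -> v != 0 -> F u v = 0 ->
  a *: u + b *: v != 0 ->
  exists al be : R, forall x, F (a *: u + b *: v) x = al * F u x + be * F v x.
Proof.
move=> u0 v0 uv w0; set w := _ + _ in w0 *.
have [[ul uu _] [vl vv _]] := (Fpair u0, Fpair v0).
have wl := Flin w0.
exists (F w (u - F v u *: v)), (F w v) => x.
pose y := x - F u x *: (u - F v u *: v) - F v x *: v.
have wy : F w y = 0.
  apply: duality_orth_span => //; rewrite /y.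
    by rewrite !(lin_funE ul) uu uv; ring.
  by rewrite !(lin_funE vl) vv; ring.
have xE : x = y + F u x *: (u - F v u *: v) + F v x *: v by rewrite /y; vect R V.
clearbody y; rewrite {1}xE 2!(lin_funD wl) wy !(lin_funZ wl); ring.
Qed.

(** Replacing [v] by its part [v'] in the kernel of [F u] reduces to the orthogonal case; [F v'] is
    recovered from [F u] and [F v], which are not parallel by injectivity. *)
Lemma duality_comb u v (a b : R) : free2 u v -> a *: u + b *: v != 0 ->
  exists al be : R, forall x, F (a *: u + b *: v) x = al * F u x + be * F v x.
Proof.
move=> uv w0.
have u0 := free2_neq0 uv; have v0 := free2_neq0 (free2C uv).
have [ul uu _] := Fpair u0.
pose v' := v - F u v *: u.
have v'0 : v' != 0.
  apply/eqP => v'0; have [|_ /eqP] := uv (- F u v) 1; last by rewrite oner_eq0.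
  by rewrite -[RHS]v'0 /v'; vect R V.
have uv' : F u v' = 0 by rewrite /v' !(lin_funE ul) uu; ring.
have vE : v = F u v *: u + 1 *: v' by rewrite /v'; vect R V.
have [al [be]] : exists al be : R, forall x, F v x = al * F u x + be * F v' x.
  by rewrite {1}vE; apply: duality_comb_orth => //; rewrite -vE.
move=> vcomb.
have wE : a *: u + b *: v = (a + b * F u v) *: u + b *: v' by rewrite /v'; vect R V.
rewrite wE in w0 *.
have [al' [be' wcomb]] := duality_comb_orth u0 v'0 uv' w0.
have be0 : be != 0.
  apply/eqP => be0.
  have [c0 vu] : al != 0 /\ al *: v = u.
    by apply: duality_parallel => // x; rewrite vcomb be0; ring.
  have [|/eqP] := uv 1 (- al); last by rewrite oner_eq0.
  by rewrite -vu; vect R V.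
exists (al' - be' * al / be), (be' / be) => x.
by rewrite wcomb vcomb; field.
Qed.

(** Test at [x] with [F v x = 0] and [F u x = 1], so that [al = F (u + v) x] and [|x - u| < |x|]. If
    [al < 0], the splitting of [(1 - al) x - al v] into [x - al (u + v)] and [- al (x - u)] makes it
    shorter than [(1 - al) |x|], although [x] is Birkhoff orthogonal to [v]. *)
Lemma duality_add_pos u v : free2 u v ->
  forall al be : R, (forall x, F (u + v) x = al * F u x + be * F v x) -> 0 < al.
Proof.
move=> uv al be comb.
have u0 := free2_neq0 uv; have v0 := free2_neq0 (free2C uv).
have w0 : u + v != 0.
  apply/eqP => uv0; have [|/eqP] := uv 1 1; last by rewrite oner_eq0.
  by rewrite -uv0; vect R V.
have [[ul uu uc] [vl vv vc]] := (Fpair u0, Fpair v0).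
have [wl ww wc] := Fpair w0.
have [x vx ux] : exists2 x, F v x = 0 & F u x = 1.
  have [x /not_implyP[vx /eqP ux]] : exists x, ~ (F v x = 0 -> F u x = 0).
    apply/existsNP => h.
    have [c0 uE] : F u v != 0 /\ F u v *: u = v.
      apply: duality_parallel => // x.
      have /h : F v (x - F v x *: v) = 0 by rewrite !(lin_funE vl) vv; ring.
      by rewrite !(lin_funE ul); lra.
    have [|_ /eqP] := uv (- F u v) 1; last by rewrite oner_eq0.
    by rewrite -[in X in _ + X]uE; vect R V.
  exists ((F u x)^-1 *: x); first by rewrite (lin_funZ vl) vx mulr0.
  by rewrite (lin_funZ ul) mulVf.
have alE : F (u + v) x = al by rewrite comb vx ux; ring.
have al0 : al != 0.
  apply/eqP => al0.
  have [c0 wE] : be != 0 /\ be *: (u + v) = v.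
    by apply: duality_parallel => // y; rewrite comb al0; ring.
  have [|be0 _] := uv be (be - 1); last by rewrite be0 eqxx in c0.
  by rewrite -[RHS](subrr v) -{2}wE; vect R V.
rewrite lt_neqAle eq_sym al0 leNgt; apply/negP => {al0} al0.
have xv : birkhoff x v by apply/Fbirkhoff.
have xu : `|x - u| < `|x|.
  rewrite ltNge; apply/negP => h.
  have /(Fbirkhoff _ u0) : birkhoff x u.
    move=> t; apply: le_trans h _; apply: le_trans (uc _).
    rewrite !(lin_funE ul) ux uu (_ : x - u = x + t *: u - (1 + t * 1) *: u) //.
    by vect R V.
  by rewrite ux => /eqP; rewrite oner_eq0.
have xw := wc x; rewrite alE in xw.
have := birkhoff_norm_ge (1 - al) (- al) xv.
have -> : (1 - al) *: x + - al *: v = (x - al *: (u + v)) + (- al) *: (x - u).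
  by vect R V.
have := ler_normD (x - al *: (u + v)) ((- al) *: (x - u)).
rewrite normrZ gtr0_norm; last by lra.
rewrite (@gtr0_norm _ (1 - al)); last by lra.
nra.
Qed.

(** Pick [x] in the plane of [u, v] with [F w x = 0], and [w'] in that plane killed by a functional
    norming [x], so that [F w' x = 0]. Then [F w] and [F w'] are combinations of [F u] and [F v]
    vanishing at [x]; they are parallel, hence so are [w] and [w']. *)
Lemma duality_free3 u v w (al be : R) : free2 u v ->
  (forall a b : R, w <> a *: u + b *: v) -> w != 0 ->
  ~ (forall x, F w x = al * F u x + be * F v x).
Proof.
move=> uv wuv w0 comb.
have [a [b []]] := free2_span_kernel (Flin w0) uv.
move xE : (_ + _) => x x0 wx.
have [phi [phil phile phix]] := norming_functional x.
have [a' [b' []]] := free2_span_kernel phil uv.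
move w'E : (_ + _) => w' w'0 phiw'.
have w'x : F w' x = 0.
  apply/(Fbirkhoff _ w'0) => t; rewrite -phix.
  rewrite (_ : phi x = phi (x + t *: w')).
    by apply: le_trans (ler_norm _) (phile _).
  by rewrite (lin_funD phil) (lin_funZ phil) phiw' mulr0 addr0.
have [al' [be' comb']] : exists al be : R, forall x, F w' x = al * F u x + be * F v x.
  by rewrite -w'E; apply: duality_comb => //; rewrite w'E.
have [al'' [be'' comb'']] : exists al be : R, forall y, F x y = al * F u y + be * F v y.
  by rewrite -xE; apply: duality_comb => //; rewrite xE.
have ex := comb'' x; rewrite Fid // in ex.
have e1 := comb x; rewrite wx in e1.
have e2 := comb' x; rewrite w'x in e2.
(* [F u] and [F v] do not both vanish at [x], because [F x x = 1] is a combination of their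
   values. *)
have det : al * be' - al' * be = 0.
  have h1 : (al * be' - al' * be) * F u x = 0.
    have -> : (al * be' - al' * be) * F u x =
      be' * (al * F u x + be * F v x) - be * (al' * F u x + be' * F v x) by ring.
    by rewrite -e1 -e2; ring.
  have h2 : (al * be' - al' * be) * F v x = 0.
    have -> : (al * be' - al' * be) * F v x =
      al * (al' * F u x + be' * F v x) - al' * (al * F u x + be * F v x) by ring.
    by rewrite -e1 -e2; ring.
  move: h1 h2; set D := _ - _ => h1 h2; rewrite -[LHS]mulr1 ex.
  have -> : D * (al'' * F u x + be'' * F v x) =
    al'' * (D * F u x) + be'' * (D * F v x) by ring.
  by rewrite h1 h2 !mulr0 addr0.
have [c wE] : exists c, forall y, F w y = c * F w' y.
  have [al'0|al'0] := eqVneq al' 0; last first.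
    exists (al / al') => y; rewrite comb comb'.
    have -> : be = al * be' / al'.
      by apply/eqP; rewrite -(inj_eq (mulIf al'0)) divfK //; apply/eqP; lra.
    by field.
  have be'0 : be' != 0.
    apply/eqP => be'0; have := comb' w'; rewrite Fid // al'0 be'0 !mul0r addr0.
    by move/eqP; rewrite oner_eq0.
  exists (be / be') => y; rewrite comb comb' al'0.
  have -> : al = 0.
    by apply/eqP; rewrite -(inj_eq (mulIf be'0)) mul0r; apply/eqP; move: det; rewrite al'0; lra.
  by field.
have [c0 cw] := duality_parallel w'0 w0 wE.
apply: (wuv (c^-1 * a') (c^-1 * b')).
rewrite -!scalerA -scalerDr w'E -cw scalerA mulVf // scale1r //.
Qed.

End Duality.

(** * Linearization of the duality on a plane *)

(** Nonnegativity gives monotonicity; placing [n x] between consecutive integers then bounds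
    [n |s x - x s 1|] by [s 1]. *)
Lemma additive_nonneg_linear {R : realType} (s : R -> R) :
  (forall x y, s (x + y) = s x + s y) -> (forall x, 0 <= x -> 0 <= s x) ->
  forall x, s x = x * s 1.
Proof.
move=> sD spos.
have s0 : s 0 = 0 by have := sD 0 0; rewrite addr0; lra.
have sN x : s (- x) = - s x by have := sD x (- x); rewrite subrr s0; lra.
have smono x y : x <= y -> s x <= s y.
  move=> xy; have /spos : 0 <= y - x by lra.
  by rewrite sD sN; lra.
have sn n x : s (n%:R * x) = n%:R * s x.
  elim: n => [|n IH]; first by rewrite !mul0r.
  by rewrite -natr1 !mulrDl !mul1r sD IH.
suff H x : 0 <= x -> s x = x * s 1.
  move=> x; have [/H//|x0] := leP 0 x.
  have /H : 0 <= - x by lra.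
  by rewrite sN; lra.
move=> x0; apply/eqP; rewrite -subr_eq0 -normr_le0 leNgt; apply/negP => d0.
pose n := Num.bound (s 1 / `|s x - x * s 1|).
have nb : s 1 < n%:R * `|s x - x * s 1|.
  by rewrite -ltr_pdivrMr //; apply: archi_boundP; rewrite divr_ge0 // spos.
have /Num.Theory.truncn_itv/andP[kle klt] : 0 <= n%:R * x by rewrite mulr_ge0.
move: kle klt; set k := Num.truncn _ => kle klt.
have := smono _ _ kle; have := smono _ _ (ltW klt).
rewrite !sn -[k%:R]mulr1 -[k.+1%:R]mulr1 !sn.
have s1 := spos 1 ler01.
have := ler_wpM2r s1 kle; have := ler_wpM2r s1 (ltW klt).
rewrite -natr1 => a1 a2 a3 a4.
have : `|n%:R * (s x - x * s 1)| <= s 1 by rewrite ler_norml; apply/andP; split; lra.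
by rewrite normrM normr_nat; lra.
Qed.

Section Linearization.
Context {R : realType} {V : normedModType R}.
Implicit Types (f g h : V -> R) (u v w x y z : V).
Hypothesis dim3 : dim_ge3 V.
Variable F : V -> V -> R.
Hypothesis Fpair : forall u, u != 0 -> contractive_pair u (F u).

Let Fid u : u != 0 -> F u u = 1.
Proof. by move=> /Fpair[]. Qed.

Lemma duality_free3_coef e u v (p q r : R) : free2 u v -> e != 0 ->
  (forall a b : R, e <> a *: u + b *: v) ->
  (forall x, p * F e x + q * F u x + r * F v x = 0) -> [/\ p = 0, q = 0 & r = 0].
Proof.
move=> uv e0 euv h.
have u0 := free2_neq0 uv; have v0 := free2_neq0 (free2C uv).
have p0 : p = 0.
  apply/eqP/negPn/negP => pn.
  apply: (duality_free3 dim3 Fpair (al := - q / p) (be := - r / p) uv euv e0) => x.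
  by apply: (mulfI pn); have := h x => hx; transitivity (- q * F u x - r * F v x);
    [lra|field].
have q0 : q = 0.
  apply/eqP/negPn/negP => qn.
  have [c0 uE] : - r / q != 0 /\ (- r / q) *: u = v.
    apply: (duality_parallel dim3 Fpair) => // x.
    apply: (mulfI qn); have := h x; rewrite p0 => hx.
    by transitivity (- r * F v x); [lra|field].
  have [|/eqP] := uv (- r / q) (- 1); first by rewrite uE; vect R V.
  by rewrite (negPf c0).
split=> //; have := h v; rewrite p0 q0 Fid //; lra.
Qed.

Section Plane.
Variables e u v : V.
Hypotheses (uv : free2 u v) (euv : forall a b : R, e <> a *: u + b *: v).

Let inE w := exists a b : R, w = a *: u + b *: v.

Let e0 : e != 0.
Proof. by apply/eqP => e0; apply: (euv (a := 0) (b := 0)); rewrite !scale0r addr0. Qed.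

Let inED w1 w2 (a b : R) : inE w1 -> inE w2 -> inE (a *: w1 + b *: w2).
Proof.
move=> [a1 [b1 ->]] [a2 [b2 ->]].
by exists (a * a1 + b * a2), (a * b1 + b * b2); vect R V.
Qed.

Let free_e w (a : R) : inE w -> w != 0 -> free2 (e + a *: w) w.
Proof.
move=> wE w0 p q h.
have p0 : p = 0.
  apply/eqP/negPn/negP => pn.
  have [c [d cd]] := inED (- a) (- q / p) wE wE.
  apply: (@euv c d); rewrite -cd; apply: (scalerI pn).
  transitivity ((p *: (e + a *: w) + q *: w) + p *: (- a *: w + - q / p *: w)).
    by vect R V; field.
  by rewrite h add0r.
move: h; rewrite p0 scale0r add0r => /eqP; rewrite scaler_eq0 (negPf w0) orbF.
by move/eqP.
Qed.

(** The vector [e] outside the plane fixes the scale: both coefficients of [F (e + w)] are positive,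
    and their ratio is the factor by which [F w] gets rescaled. *)
Let ratio_ex w : exists r : R, inE w -> w != 0 -> 0 < r /\
  exists2 a : R, 0 < a & forall x, F (e + w) x = a * (F e x + r * F w x).
Proof.
have [wE|] := pselect (inE w); last by exists 0.
have [->|w0] := eqVneq w 0; first by exists 0.
have ew : free2 e w by have := free_e (a := 0) wE w0; rewrite scale0r addr0.
have ew0 : 1 *: e + 1 *: w != 0.
  by apply/eqP => /ew[/eqP]; rewrite oner_eq0.
have [al [be comb]] := duality_comb dim3 Fpair ew ew0.
rewrite !scale1r in comb.
have al0 := duality_add_pos dim3 Fpair ew comb.
have be0 : 0 < be.
  apply: (duality_add_pos dim3 Fpair (free2C ew) (be := al)) => x.
  by rewrite addrC comb addrC.
exists (be / al) => _ _; split; first exact: divr_gt0.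
by exists al => // x; rewrite comb; field; rewrite gt_eqF.
Qed.

Let rho w := sval (cid (ratio_ex w)).

Let rho_gt0 w : inE w -> w != 0 -> 0 < rho w.
Proof. by move=> wE w0; have [] := svalP (cid (ratio_ex w)) wE w0. Qed.

Let rhoE w : inE w -> w != 0 ->
  exists2 a : R, 0 < a & forall x, F (e + w) x = a * (F e x + rho w * F w x).
Proof. by move=> wE w0; have [] := svalP (cid (ratio_ex w)) wE w0. Qed.

(** The value 0 at [w = 0] keeps sums and multiples with a zero term valid. *)
Let g w x := if w == 0 then 0 else rho w * F w x.

Let gE w x : w != 0 -> g w x = rho w * F w x.
Proof. by rewrite /g => /negPf->. Qed.

(** Grouping [e + w1 + w2] in three ways gives three expressions of its functional; the coefficients
    of the independent [F e], [F w1], [F w2] are compared. *)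
Let gD w1 w2 x : inE w1 -> inE w2 -> free2 w1 w2 -> g (w1 + w2) x = g w1 x + g w2 x.
Proof.
move=> E1 E2 w12; have n1 := free2_neq0 w12; have n2 := free2_neq0 (free2C w12).
have E12 : inE (w1 + w2) by have := inED 1 1 E1 E2; rewrite !scale1r.
have n12 : 1 *: w1 + 1 *: w2 != 0 by apply/eqP => /w12[/eqP]; rewrite oner_eq0.
have [c [d comb]] := duality_comb dim3 Fpair w12 n12.
rewrite !scale1r in n12 comb.
have eE a b : e <> a *: w1 + b *: w2.
  by move=> ee; have [p [q pq]] := inED a b E1 E2; apply: (@euv p q); rewrite -pq.
have [al a0 F12] := rhoE E12 n12.
have split w w' : inE w -> inE w' -> w != 0 -> w' != 0 -> free2 w w' ->
    exists A B : R, forall x, F (e + (w + w')) x = A * (F e x + rho w * F w x) + B * F w' x.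
  move=> Ew Ew' nw nw' ww'.
  have [a a1 Few] := rhoE Ew nw.
  have fr : free2 (e + w) w'.
    move=> p q pq; have p0 : p = 0.
      apply/eqP/negPn/negP => pn.
      have [c' [d' cd]] := inED (- 1) (- q / p) Ew Ew'.
      apply: (@euv c' d'); rewrite -cd; apply: (scalerI pn).
      transitivity ((p *: (e + w) + q *: w') + p *: (- 1 *: w + - q / p *: w')).
        by vect R V; field.
      by rewrite pq add0r.
    split=> //; move: pq; rewrite p0 scale0r add0r => /eqP.
    by rewrite scaler_eq0 (negPf nw') orbF => /eqP.
  have nn : 1 *: (e + w) + 1 *: w' != 0 by apply/eqP => /fr[/eqP]; rewrite oner_eq0.
  have [A [B AB]] := duality_comb dim3 Fpair fr nn.
  exists (A * a), B => y; rewrite -mulrA -Few -AB !scale1r addrA //.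
have [A [B FAB]] := split w1 w2 E1 E2 n1 n2 w12.
have [A' [B' FAB']] := split w2 w1 E2 E1 n2 n1 (free2C w12).
have [q1 q2 q3] : [/\ A - A' = 0, A * rho w1 - B' = 0 & B - A' * rho w2 = 0].
  apply: (@duality_free3_coef e w1 w2) => // y.
  by have := FAB y; rewrite [w1 + w2]addrC FAB'; lra.
have [q4 q5 q6] : [/\ al - A = 0, al * rho (w1 + w2) * c - A * rho w1 = 0
    & al * rho (w1 + w2) * d - B = 0].
  apply: (@duality_free3_coef e w1 w2) => // y.
  by have := FAB y; rewrite F12 comb; lra.
rewrite !gE // comb; apply: (mulfI (lt0r_neq0 a0)).
have AE : A = al by lra.
have A'E : A' = al by lra.
have BE : B = al * rho w2 by rewrite -A'E; lra.
rewrite AE BE in q5 q6.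
transitivity (al * rho (w1 + w2) * c * F w1 x + al * rho (w1 + w2) * d * F w2 x).
  by ring.
have -> : al * rho (w1 + w2) * c = al * rho w1 by lra.
have -> : al * rho (w1 + w2) * d = al * rho w2 by lra.
by ring.
Qed.

(** As [gD] handles independent pairs, additivity in the scalar comes from [(a w + w') + b w].
    Evaluation at [w] is nonnegative for [a >= 0], so it is linear; for [s != 0] this determines
    [rho (s w)], hence the formula at every [x]. *)
Let gZ w w' (s : R) x : inE w -> inE w' -> free2 w w' -> g (s *: w) x = s * g w x.
Proof.
move=> Ew Ew' ww'.
have w0 := free2_neq0 ww'; have w'0 := free2_neq0 (free2C ww').
have EZ t : inE (t *: w) by have := inED t 0 Ew Ew; rewrite scale0r addr0.
have free_step t s' : s' != 0 -> free2 (t *: w + w') (s' *: w).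
  move=> s'0 p q pq; have [|h p0] := ww' (p * t + q * s') p.
    by rewrite -pq; vect R V.
  split=> //; move: h; rewrite p0 mul0r add0r => /eqP.
  by rewrite mulf_eq0 (negPf s'0) orbF => /eqP.
have freeZ t : t != 0 -> free2 (t *: w) w'.
  move=> t0 p q; rewrite scalerA => /ww'[/eqP + ->].
  by rewrite mulf_eq0 (negPf t0) orbF => /eqP.
have gDw t y : g (t *: w + w') y = g (t *: w) y + g w' y.
  have [->|t0] := eqVneq t 0; first by rewrite scale0r add0r /g eqxx add0r.
  exact: gD (freeZ t t0).
have gadd a b y : g ((a + b) *: w) y = g (a *: w) y + g (b *: w) y.
  have [->|b0] := eqVneq b 0.
    by rewrite addr0 scale0r {3}/g eqxx addr0.
  have E1 : inE (a *: w + w').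
    by have := inED a 1 Ew Ew'; rewrite scale1r.
  have := gD y E1 (EZ b) (free_step a b b0).
  by rewrite addrAC -scalerDl !gDw; lra.
have gpos a : 0 <= a -> 0 <= g (a *: w) w.
  rewrite le0r => /orP[/eqP->|a0]; first by rewrite scale0r /g eqxx.
  have an0 : a != 0 by rewrite gt_eqF.
  have aw0 : a *: w != 0 by rewrite scaler_eq0 negb_or an0.
  rewrite gE // (dualityZ dim3 Fpair) // Fid // mulr1.
  by rewrite ltW // divr_gt0 // rho_gt0.
have := additive_nonneg_linear (fun a b => gadd a b w) gpos s.
rewrite scale1r; have [->|s0] := eqVneq s 0.
  by rewrite !mul0r scale0r /g eqxx.
have sw0 : s *: w != 0 by rewrite scaler_eq0 negb_or s0.
rewrite !gE // !(dualityZ dim3 Fpair) // Fid // !mulr1 => h.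
by rewrite [LHS]mulrA h; ring.
Qed.

Lemma duality_plane_linear : exists G1 G2 : V -> R,
  forall s t : R, s *: u + t *: v != 0 ->
  exists2 c : R, 0 < c & forall x, s * G1 x + t * G2 x = c * F (s *: u + t *: v) x.
Proof.
have Eu : inE u by exists 1, 0; rewrite scale1r scale0r addr0.
have Ev : inE v by exists 0, 1; rewrite scale1r scale0r add0r.
exists (g u), (g v) => s t w0.
have Ew := inED s t Eu Ev.
exists (rho (s *: u + t *: v)) => [|x]; first exact: rho_gt0.
rewrite -gE // -(gZ s x Eu Ev uv) -(gZ t x Ev Eu (free2C uv)).
have [->|s0] := eqVneq s 0; first by rewrite scale0r add0r {1}/g eqxx add0r.
have [->|t0] := eqVneq t 0; first by rewrite scale0r addr0 {2}/g eqxx addr0.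
symmetry; apply: gD.
- by have := inED s 0 Eu Eu; rewrite scale0r addr0.
- by have := inED t 0 Ev Ev; rewrite scale0r addr0.
- move=> p q; rewrite !scalerA => /uv[/eqP + /eqP].
  by rewrite !mulf_eq0 (negPf s0) (negPf t0) !orbF => /eqP-> /eqP->.
Qed.

End Plane.

End Linearization.

(** * The norm is quadratic on planes *)

(** [p t] is a subgradient of [n] at every [t], so the difference quotient between [t] and [z] lies
    between [p t] and [p z]. *)
Lemma is_derive_of_slopes {R : realType} (n p : R -> R) :
  (forall s t, (s - t) * p t <= n s - n t) -> continuous p ->
  forall t : R, is_derive t 1 n (p t).
Proof.
move=> np pc t; apply/is_derive1_caratheodory.
pose q z := if z == t then p t else (n z - n t) / (z - t).
exists q; split; last by rewrite /q eqxx.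
  move=> z; rewrite /q; have [->|zt] := eqVneq z t; first by rewrite !subrr mulr0.
  by rewrite divfK // subr_eq0.
have qp z : `|p t - q z| <= `|p t - p z|.
  rewrite /q; have [->|zt] := eqVneq z t; first by rewrite subrr.
  have := np z t; have := np t z.
  set D := n z - n t => a1 a2.
  have b1 : (z - t) * p t <= D by [].
  have b2 : D <= (z - t) * p z by rewrite /D; lra.
  have [zlt|tlt|zE] := ltgtP z t; last by rewrite zE eqxx in zt.
    have d0 : z - t < 0 by lra.
    have c1 : D / (z - t) <= p t by rewrite ler_ndivrMr // mulrC.
    have c2 : p z <= D / (z - t) by rewrite ler_ndivlMr // mulrC.
    by rewrite !ger0_norm; lra.
  have d0 : 0 < z - t by lra.
  have c1 : p t <= D / (z - t) by rewrite ler_pdivlMr // mulrC.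
  have c2 : D / (z - t) <= p z by rewrite ler_pdivrMr // mulrC.
  by rewrite !ler0_norm; lra.
apply/cvgrPdist_le => eps eps0; near=> z.
rewrite {1}/q eqxx; apply: le_trans (qp z) _.
by near: z; have /cvgrPdist_le := pc t; apply.
Unshelve. all: by end_near.
Qed.

Section Quadratic.
Context {R : realType} {V : normedModType R}.
Implicit Types (u v w x y z : V).

Variables (F : V -> V -> R) (x b : V) (G1 G2 : V -> R).
Hypothesis Fpair : forall u, u != 0 -> contractive_pair u (F u).
Hypothesis xb : free2 x b.
Hypothesis G12 : forall s t : R, s *: x + t *: b != 0 ->
  exists2 c : R, 0 < c & forall y, s * G1 y + t * G2 y = c * F (s *: x + t *: b) y.

Let x0 : x != 0. Proof. exact: free2_neq0 xb. Qed.
Let b0 : b != 0. Proof. exact: free2_neq0 (free2C xb). Qed.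

Let span0 (s t : R) : s *: x + t *: b = 0 -> s = 0 /\ t = 0.
Proof. exact: xb. Qed.

Let G1l : lin_fun G1.
Proof.
have [|c _ h] := @G12 1 0; first by rewrite scale1r scale0r addr0.
have [xl _ _] := Fpair x0.
move: h; rewrite scale1r scale0r addr0 => h a y z.
have E w : G1 w = c * F x w by have := h w; lra.
by rewrite !E xl; ring.
Qed.

Let G2l : lin_fun G2.
Proof.
have [|c _ h] := @G12 0 1; first by rewrite scale1r scale0r add0r.
have [bl _ _] := Fpair b0.
move: h; rewrite scale1r scale0r add0r => h a y z.
have E w : G2 w = c * F b w by have := h w; lra.
by rewrite !E bl; ring.
Qed.

Let B y (s t : R) := s * G1 y + t * G2 y.

(** The diagonal of the bilinear form in coordinates; [G1 b] and [G2 x] may differ a priori. *)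
Let form (s t : R) := s ^+ 2 * G1 x + s * t * (G1 b + G2 x) + t ^+ 2 * G2 b.

Let formE (s t : R) : B (s *: x + t *: b) s t = form s t.
Proof. by rewrite /B /form !(lin_funE G1l) !(lin_funE G2l); ring. Qed.

Let form_gt0 (s t : R) : s *: x + t *: b != 0 -> 0 < form s t.
Proof.
move=> w0; have [c c0 h] := G12 w0; rewrite -formE /B h.
by have [_ -> _] := Fpair w0; rewrite mulr1.
Qed.

Let line0 (t : R) : 1 *: x + t *: b != 0.
Proof. by apply/eqP => /span0[/eqP]; rewrite oner_eq0. Qed.

Let line0' (t : R) : t *: x + 1 *: b != 0.
Proof. by apply/eqP => /span0[_ /eqP]; rewrite oner_eq0. Qed.

Let Q (t : R) := form 1 t.
Let n (t : R) := `|x + t *: b|.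

Let Q_gt0 t : 0 < Q t. Proof. exact: form_gt0. Qed.

(* With z_t = x + t b, the point z_t is Birkhoff orthogonal to z_s - k z_t;
   this is the subgradient inequality for n at t. *)
Let n_slope (s t : R) : (s - t) * (n t * (G2 x + t * G2 b) / Q t) <= n s - n t.
Proof.
(* For this [k] the vector [w = z_s - k z_t], when nonzero, satisfies [F w z_t = 0]. *)
pose k := 1 + (s - t) * (G2 x + t * G2 b) / Q t.
suff : k * n t <= n s.
  move=> h; rewrite (_ : (s - t) * _ = k * n t - n t); first by lra.
  by rewrite /k; ring.
apply: (@le_trans _ _ (`|k| * n t)).
  by apply: ler_wpM2r; [exact: normr_ge0|exact: ler_norm].
pose w := (1 - k) *: x + (s - k * t) *: b.
have -> : n s = `|k *: (x + t *: b) + 1 *: w| by congr (`|_|); rewrite /w; vect R V.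
apply: birkhoff_norm_ge.
have [->|w0] := eqVneq w 0; first by move=> r; rewrite scaler0 addr0.
have [c c0 h] := G12 w0; rewrite -/w in h.
apply: contractive_pair_birkhoff (Fpair w0) _.
apply: (mulfI (lt0r_neq0 c0)); rewrite -h mulr0.
rewrite !(lin_funE G1l) !(lin_funE G2l).
have QE : Q t = G1 x + t * (G1 b + G2 x) + t ^+ 2 * G2 b by rewrite /Q /form; ring.
apply: (mulfI (lt0r_neq0 (Q_gt0 t))); rewrite /k mulr0.
have Q0 := lt0r_neq0 (Q_gt0 t).
transitivity ((s - t) * (G2 x + t * G2 b) *
  (Q t - (G1 x + t * (G1 b + G2 x) + t ^+ 2 * G2 b))); first by field.
by rewrite -QE subrr mulr0.
Qed.

Let cont_n : continuous n.
Proof. exact: norm_line_continuous. Qed.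

Let cont_form (f g : R -> R) : continuous f -> continuous g ->
  continuous (fun t => form (f t) (g t)).
Proof.
move=> fc gc t; apply: cvgD; last first.
  apply: cvgM; last exact: cvg_cst.
  by apply: cvgM; exact: gc.
apply: cvgD; (apply: cvgM; last exact: cvg_cst); apply: cvgM.
- exact: fc.
- exact: fc.
- exact: fc.
- exact: gc.
Qed.

Let cont_Q : continuous Q.
Proof. by apply: cont_form => t; [exact: cvg_cst|exact: cvg_id]. Qed.

Let n_derive (t : R) : is_derive t 1 n (n t * (G2 x + t * G2 b) / Q t).
Proof.
apply: (is_derive_of_slopes (p := fun t => n t * (G2 x + t * G2 b) / Q t)).
  exact: n_slope.
move=> {}t; apply: cvgM; last first.
  by apply: cvgV; [rewrite gt_eqF|exact: cont_Q].
apply: cvgM; first exact: cont_n.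
apply: cvgD; first exact: cvg_cst.
by apply: cvgM; [exact: cvg_id|exact: cvg_cst].
Qed.

Let Q_derive (t : R) : is_derive t 1 Q (G1 b + G2 x + (t + t) * G2 b).
Proof.
apply/is_derive1_caratheodory.
exists (fun s : R => G1 b + G2 x + (s + t) * G2 b); split => //.
  by move=> s; rewrite /Q /form; ring.
apply: cvgD; first exact: cvg_cst.
apply: cvgM; last exact: cvg_cst.
by apply: cvgD; [exact: cvg_id|exact: cvg_cst].
Qed.

Let ratio (t : R) := n t * n t * (Q t)^-1.

(** The sign is that of the constant [G2 x - G1 b], which measures the asymmetry of the form; this
    makes the ratio monotone. *)
Let ratio_derive (t : R) :
  is_derive t 1 ratio ((G2 x - G1 b) * (n t / Q t) ^+ 2).
Proof.
have Q0 : Q t != 0 by rewrite gt_eqF.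
have h := is_deriveM (is_deriveM (n_derive t) (n_derive t))
  (is_deriveV Q0 (Q_derive t)).
apply: is_derive_eq; rewrite /GRing.scale /=.
have -> : G1 b + G2 x + (t + t) * G2 b =
  2 * (G2 x + t * G2 b) + (G1 b - G2 x) by ring.
have -> : (n * n) t = n t * n t by [].
by field.
Qed.

Let ratio_mono (s t : R) : s <= t ->
  exists2 c : R, 0 <= c & ratio t - ratio s = (G2 x - G1 b) * c.
Proof.
move=> st.
have [|r _ ->] := MVT_segment st (fun r _ => ratio_derive r).
  apply: continuous_subspaceT => r; apply/differentiable_continuous/derivable1_diffP.
  by have [] := ratio_derive r.
exists ((n r / Q r) ^+ 2 * (t - s)); last by ring.
by rewrite mulr_ge0 ?sqr_ge0 ?subr_ge0.
Qed.

(** The ratio in the coordinate [s = t^-1]; its value at 0 is the common limit at both ends of the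
    line. *)
Let far (s : R) := `|b + s *: x| * `|b + s *: x| * (form s 1)^-1.

Let far_cont : {for 0, continuous far}.
Proof.
apply: cvgM; first by apply: cvgM; exact: norm_line_continuous.
apply: cvgV.
  by rewrite gt_eqF //; apply: form_gt0; exact: line0'.
by apply: cont_form => t; [exact: cvg_id|exact: cvg_cst].
Qed.

Let ratio_far (s : R) : s != 0 -> ratio s^-1 = far s.
Proof.
move=> s0; rewrite /ratio /far /n /Q.
have -> : x + s^-1 *: b = s^-1 *: (b + s *: x) by vect R V; field.
have -> : form 1 s^-1 = s ^- 2 * form s 1 by rewrite /form; field.
rewrite normrZ mulrACA -normrM -invfM -expr2 ger0_norm ?invr_ge0 ?sqr_ge0 //.
have f0 : form s 1 != 0 by rewrite gt_eqF // form_gt0.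
by field; rewrite f0 s0.
Qed.

(* The ratio of the squared norm to the quadratic form is monotone along the
   line and has the same limit at both ends. *)
Let ratio_const (t : R) : ratio t = far 0.
Proof.
have farR : far s @[s --> 0^'+] --> far 0 by apply: cvg_at_right_filter far_cont.
have farL : far s @[s --> 0^'-] --> far 0 by apply: cvg_at_left_filter far_cont.
have right (s : R) : 0 < s -> s * (`|t| + 1) <= 1 -> t <= s^-1.
  move=> s0 st; apply: (@le_trans _ _ (`|t| + 1)); first by have := ler_norm t; lra.
  by rewrite -[leRHS]mul1r ler_pdivlMr // mulrC.
have left (s : R) : s < 0 -> - s * (`|t| + 1) <= 1 -> s^-1 <= t.
  move=> s0 st; rewrite -lerN2 -invrN; apply: (@le_trans _ _ (`|t| + 1)).
    by have := ler_norm (- t); rewrite normrN; lra.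
  by rewrite -[leRHS]mul1r ler_pdivlMr; [rewrite mulrC|lra].
have t1 : 0 < `|t| + 1 by have := normr_ge0 t; lra.
have nearR : \forall s \near 0^'+, 0 < s /\ t <= s^-1.
  near=> s; have s0 : 0 < s by [].
  split=> //; apply: right => //; rewrite -ler_pdivlMr // mul1r.
  by near: s; apply: nbhs_right_le; rewrite invr_gt0.
have nearL : \forall s \near 0^'-, s < 0 /\ s^-1 <= t.
  near=> s; have s0 : s < 0 by [].
  split=> //; apply: left => //; rewrite -ler_pdivlMr // mul1r lerNl.
  by near: s; apply: nbhs_left_ge; rewrite oppr_lt0 invr_gt0.
(* A nondecreasing ratio lies below its limit at the right end and above that at the left end; the
   other sign swaps the ends. *)
have [d0|d0] := leP 0 (G2 x - G1 b).
  apply/eqP; rewrite eq_le; apply/andP; split.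
    apply: (cvgr_to_ge farR); near=> s.
    have [s0 st] : 0 < s /\ t <= s^-1 by near: s.
    have [c c0 h] := ratio_mono st; have := mulr_ge0 d0 c0.
    by rewrite -h ratio_far ?gt_eqF // subr_ge0.
  apply: (cvgr_to_le farL); near=> s.
  have [s0 st] : s < 0 /\ s^-1 <= t by near: s.
  have [c c0 h] := ratio_mono st; have := mulr_ge0 d0 c0.
  by rewrite -h ratio_far ?lt_eqF // subr_ge0.
apply/eqP; rewrite eq_le; apply/andP; split.
  apply: (cvgr_to_ge farL); near=> s.
  have [s0 st] : s < 0 /\ s^-1 <= t by near: s.
  have [c c0 h] := ratio_mono st; have := mulr_le0_ge0 (ltW d0) c0.
  by rewrite -h ratio_far ?lt_eqF // subr_le0.
apply: (cvgr_to_le farR); near=> s.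
have [s0 st] : 0 < s /\ t <= s^-1 by near: s.
have [c c0 h] := ratio_mono st; have := mulr_le0_ge0 (ltW d0) c0.
by rewrite -h ratio_far ?gt_eqF // subr_le0.
Unshelve. all: by end_near.
Qed.

Lemma norm_quadratic_free : exists P S M : R, forall s t : R,
  `|s *: x + t *: b| ^+ 2 = s ^+ 2 * P + s * t * S + t ^+ 2 * M.
Proof.
exists (far 0 * G1 x), (far 0 * (G1 b + G2 x)), (far 0 * G2 b) => s t.
(* The direction of [b] is the point at infinity of the line, where [far 0] gives the value by
   definition. *)
have [->|s0] := eqVneq s 0.
  rewrite scale0r add0r normrZ exprMn (real_normK (num_real t)) /far.
  rewrite scale0r addr0 /form.
  have m0 : G2 b != 0.
    have := form_gt0 (line0' 0); rewrite /form => h; rewrite gt_eqF //.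
    by move: h; rewrite expr0n /= !mul0r add0r expr1n mul1r; lra.
  by field; rewrite ?m0.
have -> : s *: x + t *: b = s *: (x + (t / s) *: b) by vect R V; field.
rewrite normrZ exprMn (real_normK (num_real s)) -/(n _).
have -> : n (t / s) ^+ 2 = far 0 * Q (t / s).
  by rewrite -(ratio_const (t / s)) /ratio expr2 divfK // gt_eqF.
by rewrite /Q /form; field.
Qed.

End Quadratic.

(** * From quadratic planes to an inner product *)

Section Hilbert.
Context {R : realType} {V : normedModType R}.
Implicit Types (u v w x y z : V).

Let polar x y : R := (`|x + y| ^+ 2 - `|x - y| ^+ 2) / 4.

(** Evaluation at (1, 0), (0, 1), (1, 1) and (1, -1) identifies the coefficients; dependent pairs
    are multiples of one vector. *)
Lemma norm_quadratic x y :
  (free2 x y -> exists P S M : R, forall s t : R,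
    `|s *: x + t *: y| ^+ 2 = s ^+ 2 * P + s * t * S + t ^+ 2 * M) ->
  forall s t : R, `|s *: x + t *: y| ^+ 2 =
    s ^+ 2 * `|x| ^+ 2 + 2 * s * t * polar x y + t ^+ 2 * `|y| ^+ 2.
Proof.
have normZ2 a z : `|a *: z| ^+ 2 = a ^+ 2 * `|z| ^+ 2.
  by rewrite normrZ exprMn (real_normK (num_real a)).
have para (c s t : R) z : `|s *: z + t *: (c *: z)| ^+ 2 =
    s ^+ 2 * `|z| ^+ 2 + 2 * s * t * polar z (c *: z) + t ^+ 2 * `|c *: z| ^+ 2.
  have -> : s *: z + t *: (c *: z) = (s + t * c) *: z by vect R V.
  rewrite /polar (_ : z + c *: z = (1 + c) *: z); last by vect R V.
  rewrite (_ : z - c *: z = (1 - c) *: z); last by vect R V.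
  by rewrite !normZ2; field.
have polarC z1 z2 : polar z1 z2 = polar z2 z1.
  by rewrite /polar [z1 + z2]addrC -[`|z1 - z2|]normrN opprB.
have [xy /(_ xy)[P [S [M h]]] s t|nxy _] := pselect (free2 x y).
  have hx := h 1 0; have hy := h 0 1; have hp := h 1 1; have hm := h 1 (- 1).
  rewrite scale1r scale0r addr0 in hx; rewrite scale1r scale0r add0r in hy.
  rewrite !scale1r in hp; rewrite scale1r scaleN1r in hm.
  by rewrite /polar h hx hy hp hm; field.
move: nxy => /existsNP[a /existsNP[b /not_implyP[ab]]].
have [a0|a0] := eqVneq a 0; last first.
  move=> _ s t; have -> : x = (- b / a) *: y.
    apply: (scalerI a0); apply/eqP; rewrite -subr_eq0; apply/eqP.
    by rewrite -ab; vect R V; field.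
  by rewrite addrC para polarC; ring.
have [b0|b0] := eqVneq b 0; first by rewrite a0 b0; case.
move=> _ s t; have -> : y = 0 *: x.
  apply: (scalerI b0); rewrite scale0r scaler0.
  by move: ab; rewrite a0 scale0r add0r.
exact: para.
Qed.

(** Four parallelograms give the additivity of [polar]; homogeneity is read off the formula on the
    plane of [x] and [z]. *)
Lemma hilbertian_of_quadratic :
  (forall x y, free2 x y -> exists P S M : R, forall s t : R,
    `|s *: x + t *: y| ^+ 2 = s ^+ 2 * P + s * t * S + t ^+ 2 * M) ->
  hilbertian V.
Proof.
move=> /(_ _ _)/norm_quadratic quad; exists polar.
have parallelogram x y : `|x + y| ^+ 2 + `|x - y| ^+ 2 =
    2 * `|x| ^+ 2 + 2 * `|y| ^+ 2.
  have := quad x y 1 1; have := quad x y 1 (- 1); rewrite !scale1r scaleN1r.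
  by move=> -> ->; ring.
have polarD x y z : polar (x + y) z = polar x z + polar y z.
  have := parallelogram (x + z) y; have := parallelogram (y + z) x.
  have := parallelogram (x - z) y; have := parallelogram (y - z) x.
  rewrite /polar.
  have -> : y - z + x = x + y - z by vect R V.
  have -> : x - z + y = x + y - z by vect R V.
  have -> : y + z + x = x + y + z by vect R V.
  have -> : x + z + y = x + y + z by vect R V.
  have -> : y - z - x = - (x + z - y) by vect R V.
  have -> : x - z - y = - (y + z - x) by vect R V.
  by rewrite !normrN; lra.
have polarZ a x z : polar (a *: x) z = a * polar x z.
  have := quad x z a 1; have := quad x z a (- 1); rewrite !scale1r scaleN1r.
  by move=> h1 h2; rewrite {1}/polar h1 h2; field.
split; [|split] => [x y|a x y z|x].
- by rewrite /polar [x + y]addrC -[`|x - y|]normrN opprB.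
- by rewrite polarD polarZ.
- have := quad x x 1 1; rewrite !scale1r; rewrite /polar subrr normr0.
  have -> : x + x = 2 *: x by vect R V.
  by rewrite normrZ exprMn normr_nat; lra.
Qed.

End Hilbert.

Theorem theorem2p6 (R : realType) (V : completeNormedModType R) :
  dim_ge3 V -> (forall u : V, flinn u) -> hilbertian V.
Proof.
move=> dim3 allflinn.
have /choice[F Fpair] : forall u : V, exists f, u != 0 -> contractive_pair u f.
  (* The zero functional is a default at [u = 0], where no contractive pair exists. *)
  move=> u; have [u0|u0] := eqVneq u 0; first by exists (fun=> 0).
  by have [f fP] := flinn_contractive u0 (allflinn u); exists f.
apply: hilbertian_of_quadratic => x y xy.
have [e exy] := dim_ge3_notin_span x y dim3.
have [G1 [G2 G12]] := duality_plane_linear dim3 Fpair xy exy.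
exact: norm_quadratic_free Fpair xy G12.
Qed.
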